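(* Let $n\ge 2$ and $2<p<4$. Then $c(n,p)=J_p(\sigma_{n-1})$, and $\sigma_{n-1}$ is the unique minimizer of $J_p$ over $\mathcal{P}_0(\mathbb{S}^{n-1})$.
   Context: $\mathcal{P}_0(\mathbb{S}^{n-1})$ is the set of Borel probability measures $\mu$ on the unit sphere $\mathbb{S}^{n-1}\subset\mathbb{R}^n$ with barycenter $\int v\,d\mu(v)=0$. For such $\mu$, $J_p(\mu)=\iint_{\mathbb{S}^{n-1}\times\mathbb{S}^{n-1}}|v-w|^p\,d\mu(v)\,d\mu(w)$, and $c(n,p)=\inf_{\mu\in\mathcal{P}_0(\mathbb{S}^{n-1})}J_p(\mu)$. $\sigma_{n-1}=\mathcal{H}^{n-1}(\mathbb{S}^{n-1})^{-1}\mathcal{H}^{n-1}\lfloor_{\mathbb{S}^{n-1}}$ is the uniform probability measure on the sphere. *)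

(* Defs.v *)
From HB Require Import structures.
From mathcomp Require Import all_boot all_order all_algebra.
From mathcomp Require Import all_classical all_reals all_analysis.

Set Implicit Arguments.
Unset Strict Implicit.
Unset Printing Implicit Defensive.
Import Order.TTheory GRing.Theory Num.Theory.
Import numFieldNormedType.Exports.
Local Open Scope classical_set_scope.
Local Open Scope ring_scope.

Section Hausdorff.
Local Open Scope ereal_scope.
Context {R : realType} {T : Type}.
Variables (dist : T -> T -> R) (s : R).
Implicit Types (A B U : set T) (delta : R).

(* [diam set0 = -oo], so that empty sets are always admitted in coverings. *)
Definition diam U : \bar R :=
  ereal_sup [set z | exists x y, [/\ U x, U y & z = (dist x y)%:E]].

(* The empty set has weight 0 even when [s = 0] (whereas [0 `^ 0 = 1]). *)
Definition hgauge U : \bar R := if U == set0 then 0 else diam U `^ s.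

Definition hcover delta A : set ((set T)^nat) :=
  [set U | (forall k, diam (U k) <= delta%:E) /\ A `<=` \bigcup_k U k].

Definition hausdorff_delta delta A : \bar R :=
  ereal_inf [set \sum_(k <oo) hgauge (U k) | U in hcover delta A].

(* The Hausdorff measure, without the multiplicative constant depending only
   on [s] that some authors include; it disappears in the uniform measure. *)
Definition hausdorff A : \bar R :=
  ereal_sup [set hausdorff_delta delta A | delta in [set delta | (0 < delta)%R]].

Lemma diam0 : diam set0 = -oo.
Proof.
rewrite /diam; set X := [set _ | _]; suff -> : X = set0 by rewrite ereal_sup0.
by apply/seteqP; split => // z [x [y []]].
Qed.

Lemma hgauge0 : hgauge set0 = 0.
Proof. by rewrite /hgauge eqxx. Qed.

Lemma hgauge_ge0 U : 0 <= hgauge U.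
Proof. by rewrite /hgauge; case: ifPn => // _; exact: poweR_ge0. Qed.

Lemma hausdorff_delta_ge0 delta A : 0 <= hausdorff_delta delta A.
Proof.
apply: le_ereal_inf_tmp => x [U _ <-].
by apply: nneseries_ge0 => k _ _; exact: hgauge_ge0.
Qed.

Lemma hausdorff_delta_le delta A : (0 < delta)%R ->
  hausdorff_delta delta A <= hausdorff A.
Proof. by move=> d0; apply: ereal_sup_ubound; exists delta. Qed.

Lemma hausdorff_ge0 A : 0 <= hausdorff A.
Proof.
exact: (le_trans (hausdorff_delta_ge0 1 A) (hausdorff_delta_le A ltr01)).
Qed.

Lemma hausdorff0 : hausdorff set0 = 0.
Proof.
apply/eqP; rewrite eq_le hausdorff_ge0 andbT.
apply: ge_ereal_sup => _ [delta d0 <-].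
apply: ereal_inf_lbound; exists (fun=> set0).
  by split => // k; rewrite diam0 leNye.
by rewrite eseries0// => k _ _; rewrite hgauge0.
Qed.

Lemma le_hausdorff : {homo hausdorff : A B / A `<=` B >-> A <= B}.
Proof.
move=> A B AB; apply: ge_ereal_sup => _ [delta d0 <-].
apply: (le_trans _ (hausdorff_delta_le B d0)).
apply: le_ereal_inf_tmp => _ [U [dU BU] <-]; apply: ereal_inf_lbound.
by exists U => //; split => //; exact: subset_trans BU.
Qed.

Lemma hausdorff_delta_sigma_subadditive delta :
  sigma_subadditive (hausdorff_delta delta).
Proof.
pose mu := hausdorff_delta delta.
move=> A; have [[i ioo]|] := pselect (exists i, mu (A i) = +oo).
  rewrite (eseries_pinfty _ _ ioo) ?leey// => n _.
  by rewrite -ltNye (lt_le_trans _ (hausdorff_delta_ge0 _ _)).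
rewrite -forallNE => Aoo.
suff add2e (e : {posnum R}) :
    mu (\bigcup_n A n) <= \sum_(i <oo) mu (A i) + e%:num%:E.
  by apply/lee_addgt0Pr => _/posnumP[].
rewrite (le_trans _ (epsilon_trick _ _ _))//; last first.
  by move=> n; exact: hausdorff_delta_ge0.
pose P n (B : (set T)^nat) := hcover delta (A n) B /\
  \sum_(k <oo) hgauge (B k) <= mu (A n) + (e%:num / (2 ^ n.+1)%:R)%:E.
have [G PG] : {G : ((set T)^nat)^nat & forall n, P n (G n)}.
  apply: (@choice _ _ P) => n; rewrite /P /mu /hausdorff_delta.
  set S := (X in ereal_inf X); move infS : (ereal_inf S) => iS.
  case: iS infS => [r Sr|Soo|Soo].
  - have en1 : (0 < e%:num / (2 ^ n.+1)%:R)%R by [].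
    have /(lb_ereal_inf_adherent en1) : ereal_inf S \is a fin_num by rewrite Sr.
    move=> [x [B AnB muBx] xS].
    by exists B; split => //; rewrite muBx -Sr; exact/ltW.
  - by have := Aoo n; rewrite /mu /hausdorff_delta Soo.
  - by have := hausdorff_delta_ge0 delta (A n); rewrite /hausdorff_delta Soo.
have muG_ge0 x : 0 <= (hgauge \o uncurry G) x by exact: hgauge_ge0.
apply: (@le_trans _ _ (\esum_(i in setT) (hgauge \o uncurry G) i)).
  rewrite /mu /hausdorff_delta; apply: ereal_inf_lbound => /=.
  have /card_esym/ppcard_eqP[f] := card_nat2.
  exists (uncurry G \o f).
    split => [i|]; first by rewrite /=; case: (f i) => a b; exact: (PG a).1.1.
    move=> t [i _ Ait]; have [j _ Bijt] := (PG i).1.2 _ Ait; exists (f^-1%FUN (i, j)) => //=.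
    by rewrite invK ?inE.
  rewrite -(esum_pred_image (hgauge \o uncurry G) _ xpredT) ?[fun=> _]set_true//.
  by rewrite image_eq.
rewrite (_ : esum _ _ = \sum_(i <oo) \sum_(j <oo) hgauge (G i j)); last first.
  pose J : nat -> set (nat * nat) := fun i => [set (i, j) | j in setT].
  rewrite (_ : setT = \bigcup_k J k); last first.
    by rewrite predeqE => -[a b]; split => // _; exists a => //; exists b.
  rewrite esum_bigcupT /=; last 2 first.
    - apply/trivIsetP => i j _ _ ij.
      rewrite predeqE => -[n m] /=; split => //= -[] [_] _ [<-{n} _].
      by move=> [m' _] [] /esym/eqP; rewrite (negbTE ij).
    - by move=> /= [n m]; exact: hgauge_ge0.
  rewrite -(image_id [set: nat]) -fun_true esum_pred_image//; last first.
    by move=> n _; apply: esum_ge0 => x _; exact: muG_ge0.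
  apply: eq_eseriesr => /= j _.
  rewrite -(esum_pred_image (hgauge \o uncurry G) (pair j) predT)//=; last 2 first.
    by move=> *; exact: hgauge_ge0.
    by move=> ? ? _ _; exact: (@can_inj _ _ _ snd).
  by congr esum; rewrite predeqE => -[a b]; split; move=> [i _ <-]; exists i.
apply: lee_lim.
- apply: is_cvg_nneseries => n *.
  by apply: nneseries_ge0 => m *; exact: (muG_ge0 (n, m)).
- apply: is_cvg_nneseries => n *; apply: adde_ge0 => //.
  exact: hausdorff_delta_ge0.
- by near=> n; apply: lee_sum => i _; exact: (PG i).2.
Unshelve. all: by end_near. Qed.

Lemma hausdorff_sigma_subadditive : sigma_subadditive hausdorff.
Proof.
move=> A; apply: ge_ereal_sup => _ [delta d0 <-].
apply: (le_trans (hausdorff_delta_sigma_subadditive delta A)).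
apply: lee_nneseries => [i _ _|i _]; first exact: hausdorff_delta_ge0.
exact: hausdorff_delta_le.
Qed.

HB.instance Definition _ := isOuterMeasure.Build R T hausdorff
  hausdorff0 hausdorff_ge0 le_hausdorff hausdorff_sigma_subadditive.

Lemma hausdorff_delta_anti (d e : R) A : (d <= e)%R ->
  hausdorff_delta e A <= hausdorff_delta d A.
Proof.
move=> de; apply: le_ereal_inf_tmp => _ [U [dU AU] <-].
apply: ereal_inf_lbound; exists U => //; split => // k.
by rewrite (le_trans (dU k))// lee_fin.
Qed.

Lemma hausdorff_metric_outer A B (e : R) : (0 < e)%R ->
  (forall x y, A x -> B y -> e <= dist x y)%R ->
  hausdorff A + hausdorff B <= hausdorff (A `|` B).
Proof.
move=> e0 AB.
have key (d : R) : (0 < d)%R -> (d < e)%R ->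
    hausdorff_delta d A + hausdorff_delta d B <= hausdorff (A `|` B).
  move=> d0 de; apply: le_trans (hausdorff_delta_le _ d0).
  apply: le_ereal_inf_tmp => _ [U [dU ABU] <-].
  pose V (C : set T) k := if `[< U k `&` C !=set0 >] then U k else set0.
  have VC C : C `<=` A `|` B -> hcover d C (V C).
    move=> CAB; split=> [k|x Cx].
      by rewrite /V; case: asboolP => // _; rewrite diam0 leNye.
    have [k _ Ukx] := ABU _ (CAB _ Cx); exists k => //.
    by rewrite /V; case: asboolP => // -[]; exists x.
  have hV C : C `<=` A `|` B ->
      hausdorff_delta d C <= \sum_(k <oo) hgauge (V C k).
    by move=> CAB; apply: ereal_inf_lbound; exists (V C) => //; exact: VC.
  apply: (le_trans (leeD (hV A _) (hV B _))) => [x|x|]; [by left|by right|].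
  rewrite -nneseriesD; [|by move=> *; exact: hgauge_ge0..].
  apply: lee_nneseries => k *.
    by apply: adde_ge0; exact: hgauge_ge0.
  rewrite /V; case: asboolP => [[x [Ux Ax]]|_]; last first.
    by case: asboolP => _; rewrite hgauge0 add0e// hgauge_ge0.
  case: asboolP => [[y [Uy By]]|_]; last by rewrite hgauge0 adde0.
  exfalso; have : (dist x y)%:E <= d%:E.
    by apply: le_trans (dU k); apply: ereal_sup_ubound; exists x, y.
  by rewrite lee_fin leNgt (lt_le_trans de)// AB.
have key2 (d d' : R) : (0 < d)%R -> (0 < d')%R ->
    hausdorff_delta d A + hausdorff_delta d' B <= hausdorff (A `|` B).
  move=> d0 d'0; pose m := Num.min (e / 2)%R (Num.min d d').
  have m0 : (0 < m)%R by rewrite !lt_min divr_gt0//= d0.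
  have me : (m < e)%R by rewrite gt_min ltr_pdivrMr// ltr_pMr// ltr1n.
  apply: le_trans (key m m0 me); apply: leeD; apply: hausdorff_delta_anti;
    by rewrite !ge_min lexx ?orbT.
have [hoo|] := eqVneq (hausdorff (A `|` B)) +oo; first by rewrite hoo leey.
move=> hABoo.
have hABf : hausdorff (A `|` B) \is a fin_num.
  by rewrite ge0_fin_numE ?hausdorff_ge0// ltey.
have hBf : hausdorff B \is a fin_num.
  rewrite ge0_fin_numE ?hausdorff_ge0//.
  by apply: le_lt_trans (le_hausdorff (@subsetUr _ A B)) _; rewrite ltey.
rewrite -leeBrDr//; apply: ge_ereal_sup => _ [d d0 <-].
have hAdf : hausdorff_delta d A \is a fin_num.
  rewrite ge0_fin_numE ?hausdorff_delta_ge0//.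
  apply: le_lt_trans (hausdorff_delta_le _ d0) _.
  by apply: le_lt_trans (le_hausdorff (@subsetUl _ A B)) _; rewrite ltey.
rewrite leeBrDr// addeC -leeBrDr//.
apply: ge_ereal_sup => _ [d' d'0 <-]; rewrite leeBrDr// addeC.
exact: key2.
Qed.

Lemma hausdorff_caratheodory (f : T -> R) :
  (forall x y, f x - f y <= dist x y)%R ->
  hausdorff.-caratheodory [set x | 0 < f x]%R.
Proof.
move=> flip; pose lvl (k : nat) : R := (k.+1%:R^-1)%R.
have lvl_gt0 k : (0 < lvl k)%R by rewrite invr_gt0.
have lvl_le i j : (i <= j)%N -> (lvl j <= lvl i)%R.
  by move=> ij; rewrite lef_pV2 ?posrE// ler_nat ltnS.
have lvl_lt i j : (i < j)%N -> (lvl j < lvl i)%R.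
  by move=> ij; rewrite ltf_pV2 ?posrE// ltr_nat ltnS.
pose band (X : set T) k := X `&` [set x | lvl k.+1 <= f x < lvl k]%R.
have band_sum b X n : \sum_(k < n.+1) hausdorff (band X (b + k.*2)%N) <=
    hausdorff (X `&` [set x | lvl (b + n.*2).+1 <= f x]%R).
  elim: n => [|n IHn].
    rewrite big_ord1 double0; apply: le_hausdorff => x [Xx /andP[fx _]].
    by split.
  rewrite big_ord_recr/=; apply: le_trans (leeD IHn (lexx _)) _.
  rewrite doubleS !addnS; set m := (b + n.*2)%N.
  apply: (@le_trans _ _ (hausdorff
      ((X `&` [set x | lvl m.+1 <= f x]%R) `|` band X m.+2))).
    apply: (@hausdorff_metric_outer _ _ (lvl m.+1 - lvl m.+2)%R).
      by rewrite subr_gt0 lvl_lt.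
    move=> x y [_ /= fx] [_ /andP[_ fy]]; apply: le_trans (flip x y).
    by apply: lerB => //; exact: ltW.
  apply: le_hausdorff => x [[Xx /= fx]|[Xx /andP[fx _]]]; split => //=.
  by apply: le_trans fx; apply: lvl_le; exact: leqW (leqnSn _).
have sum_double (F : nat -> \bar R) n : \sum_(k < n.*2) F k =
    \sum_(k < n) F (0 + k.*2)%N + \sum_(k < n) F (1 + k.*2)%N.
  elim: n => [|n IHn]; first by rewrite !big_ord0 adde0.
  by rewrite doubleS !big_ord_recr/= IHn -[LHS]addeA addeACA.
suff H X : hausdorff (X `&` [set x | 0 < f x]%R) +
    hausdorff (X `&` ~` [set x | 0 < f x]%R) <= hausdorff X.
  exact: le_caratheodory_measurable.
have [->|Xoo] := eqVneq (hausdorff X) +oo; first by rewrite leey.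
have Xf : hausdorff X < +oo by rewrite ltey.
have sumoo : \sum_(0 <= k <oo) hausdorff (band X k) < +oo.
  apply: (@le_lt_trans _ _ (hausdorff X + hausdorff X)); last first.
    by rewrite lte_add_pinfty.
  apply: lime_le; first by apply: is_cvg_nneseries => *; exact: hausdorff_ge0.
  apply: nearW => N; apply: (@le_trans _ _
      (\sum_(0 <= k < N.+1.*2) hausdorff (band X k))).
    apply: lee_sum_nneg_natr => //; first by move=> *; exact: hausdorff_ge0.
    by rewrite -addnn (leq_trans (leqnSn _))// leq_addr.
  rewrite big_mkord (sum_double (fun k => hausdorff (band X k))); apply: leeD;
    apply: (le_trans (band_sum _ _ _)); exact: le_hausdorff.
apply/lee_addgt0Pr => e e0.
have /fine_cvgP[tailf /cvgrPdist_lt/(_ _ e0) tail0] := nneseries_tail_cvg sumoo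
  (fun k _ => hausdorff_ge0 (band X k)).
near \oo => N.
have tailN : \sum_(N <= k <oo) hausdorff (band X k) <= e%:E.
  have fN : \sum_(N <= k <oo) hausdorff (band X k) \is a fin_num by near: N.
  have : (`|0 - fine (\sum_(N <= k <oo) hausdorff (band X k))| < e)%R.
    by near: N.
  rewrite sub0r normrN -(fineK fN) lee_fin => /ltW.
  by apply: le_trans; exact: ler_norm.
pose XN := X `&` [set x | lvl N <= f x]%R.
apply: (@le_trans _ _ ((hausdorff XN + e%:E) +
    hausdorff (X `&` ~` [set x | 0 < f x]%R))).
  apply: leeD => //; apply: (@le_trans _ _ (hausdorff
      (XN `|` \bigcup_(n in ~` `I_N) band X n))).
    apply: le_hausdorff => x [Xx /= fx0].
    have [Nx|xN] := leP (lvl N) (f x); [by left; split|right].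
    have [k0 k0x] : exists k, (lvl k <= f x)%R.
      by have [k] := ltr_add_invr fx0; rewrite add0r => /ltW kx; exists k.
    case: (ex_minnP (ex_intro (fun k => lvl k <= f x)%R k0 k0x)) => k kx kmin.
    have Nk : (N < k)%N.
      by rewrite ltnNge; apply/negP => /lvl_le/le_trans/(_ kx); rewrite leNgt xN.
    case: k Nk kx kmin => // k Nk kx kmin; exists k => /=.
      by apply/negP; rewrite -leqNgt.
    split => //=; rewrite kx/= ltNge; apply/negP => /kmin.
    by rewrite ltnn.
  apply: (le_trans (outer_measureU2 _ _ _)); apply: leeD => //.
  exact: le_trans (outer_measure_sigma_subadditive_tail _ _ _) tailN.
rewrite addeAC; apply: leeD => //.
apply: le_trans (le_hausdorff (_ : XN `|` (X `&` ~` [set x | 0 < f x]%R) `<=` X)).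
  apply: (@hausdorff_metric_outer _ _ (lvl N)) => //.
  move=> x y [_ /= fx] [_ /= /negP]; rewrite -leNgt => fy.
  apply: le_trans (flip x y); rewrite (le_trans fx)// lerBrDr gerDl//.
by move=> x [[]|[]].
Unshelve. all: by end_near. Qed.

End Hausdorff.

Section sphere.
Context (R : realType).

(* The library norm of a row vector is the sup norm, which yields the same
   topology. *)
Definition eucl_norm (m : nat) (v : 'rV[R]_m) : R :=
  Num.sqrt (\sum_(i < m) v 0 i ^+ 2).

Definition eucl_dist (m : nat) (v w : 'rV[R]_m) : R := eucl_norm (v - w).

Lemma normr_le_eucl_norm m (v : 'rV[R]_m) : `|v| <= eucl_norm v.
Proof.
rewrite [leLHS]mx_normrE; apply/bigmax_leP; split=> [|[i j] _ /=].
  exact: sqrtr_ge0.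
rewrite -sqrtr_sqr ler_wsqrtr// (ord1 i) (bigD1 j)//= lerDl.
by apply: sumr_ge0 => k _; exact: sqr_ge0.
Qed.

Variable d : nat.
Implicit Types W : set 'rV[R]_d.+1.

Lemma open_hausdorff_caratheodory (s : R) W : open W ->
  (hausdorff (@eucl_dist d.+1) s).-caratheodory W.
Proof.
move=> oW; have [->|/eqP WT] := eqVneq W setT.
  by rewrite -setC0; apply: caratheodory_measurable_setC;
    exact: caratheodory_measurable_set0.
have /set0P[z0 z0W] : ~` W != set0.
  by apply/eqP => W0; apply: WT; rewrite -[W]setCK W0 setC0.
pose D x := [set `|x - z| | z in ~` W].
have D0 x : D x !=set0 by exists `|x - z0|; exists z0.
have Dlb x : has_lbound (D x) by exists 0 => _ [z _ <-].
pose f x := inf (D x).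
have -> : W = [set x | 0 < f x].
  apply/seteqP; split => [x Wx|x /= fx].
    have /nbhs_ballP[e /= e0 xeW] : nbhs x W by exact: open_nbhs_nbhs.
    apply: (lt_le_trans e0); apply: lb_le_inf => // _ [z Wz <-].
    rewrite leNgt; apply/negP => xz; apply: Wz; apply: xeW.
    by rewrite -ball_normE.
  apply: contrapT => Wx; move: fx; apply/negP; rewrite -leNgt.
  by apply: ge_inf => //; exists x => //; rewrite subrr normr0.
apply: hausdorff_caratheodory => x y.
apply: (@le_trans _ _ `|x - y|); last exact: normr_le_eucl_norm.
rewrite lerBlDr -lerBlDl; apply: lb_le_inf => // _ [z Wz <-].
rewrite lerBlDl; apply: (@le_trans _ _ `|x - z|).
  by apply: ge_inf => //; exists z.
exact: ler_distD.
Qed.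

Definition sphere : set 'rV[R]_d.+1 := [set v | eucl_norm v = 1].

Definition usphere : Type := set_type sphere.

Lemma sphere_pole : sphere (delta_mx 0 0).
Proof.
rewrite /sphere/= /eucl_norm (bigD1 ord0)//= big1 ?addr0.
  by rewrite mxE !eqxx expr1n sqrtr1.
by move=> i /negbTE i0; rewrite mxE i0 andbF expr0n.
Qed.

HB.instance Definition _ := Topological.on usphere.
HB.instance Definition _ :=
  isPointed.Build usphere (SigSub (mem_set sphere_pole)).

(* The Borel sigma-algebra. *)
HB.instance Definition _ :=
  Measurable.copy usphere (g_sigma_algebraType (@open usphere)).

Definition sphere_val (v : usphere) : 'rV[R]_d.+1 := set_val v.

(* The restriction to the sphere of the d-dimensional Hausdorff measure of the
   euclidean space of dimension d + 1. *)
Definition surface (A : set usphere) : \bar R :=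
  hausdorff (@eucl_dist d.+1) d%:R (sphere_val @` A).

Lemma surface0 : surface set0 = 0%E.
Proof. by rewrite /surface image_set0 outer_measure0. Qed.

Lemma surface_ge0 A : (0 <= surface A)%E.
Proof. exact: outer_measure_ge0. Qed.

Lemma le_surface : {homo surface : A B / A `<=` B >-> (A <= B)%E}.
Proof. by move=> A B AB; apply: le_outer_measure; exact: image_subset. Qed.

Lemma surface_outer_sigma_subadditive : sigma_subadditive surface.
Proof.
move=> A; rewrite /surface image_bigcup.
exact: outer_measure_sigma_subadditive.
Qed.

HB.instance Definition _ := isOuterMeasure.Build R usphere surface
  surface0 surface_ge0 le_surface surface_outer_sigma_subadditive.

Lemma measurable_surface_caratheodory (A : set usphere) :
  measurable A -> surface.-caratheodory A.
Proof.
apply: smallest_sub => /=.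
  split => [|B mB|F mF].
  - exact: caratheodory_measurable_set0.
  - by rewrite setTD; exact: caratheodory_measurable_setC.
  - exact: caratheodory_measurable_bigcup.
move=> _ [W oW <-] X.
have imE (B : set 'rV[R]_d.+1) :
    sphere_val @` (X `&` sphere_val @^-1` B) = sphere_val @` X `&` B.
  apply/seteqP; split=> [_ [v [Xv Bv] <-]|_ [[v Xv <-] Bv]]; last by exists v.
  by split => //; exists v.
have := open_hausdorff_caratheodory d%:R oW (sphere_val @` X).
by rewrite -!imE.
Qed.

Lemma surface_sigma_additive : semi_sigma_additive surface.
Proof.
move=> F mF tF mUF.
by apply: (@caratheodory_measure_sigma_additive R usphere surface) => //;
  [move=> i|]; exact: measurable_surface_caratheodory.
Qed.

HB.instance Definition _ := isMeasure.Build _ usphere R surface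
  surface0 surface_ge0 surface_sigma_additive.

(* [dirac point] is the value that [mnormalize] would take if the total
   surface were 0 or infinite, which does not happen. *)
Definition uniform_sphere : probability usphere R :=
  mnormalize surface (dirac point).

Definition barycenter (mu : probability usphere R) : 'rV[R]_d.+1 :=
  \row_i \int[mu]_v sphere_val v 0 i.

Definition centered_probability : set (probability usphere R) :=
  [set mu | barycenter mu = 0].

Definition energy (p : R) (mu : probability usphere R) : \bar R :=
  (\int[mu]_v \int[mu]_w
    (eucl_dist (sphere_val v) (sphere_val w) `^ p)%:E)%E.

End sphere.

(* For n >= 1, the infimum is over measures on the unit sphere of R^n, which
   is [usphere R n.-1]. *)
Definition min_energy (R : realType) (n : nat) (p : R) : \bar R :=
  ereal_inf [set energy p mu | mu in @centered_probability R n.-1].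

(* Main.v *)
Require Import Defs.
From HB Require Import structures.
From mathcomp Require Import all_boot all_order all_algebra.
From mathcomp Require Import all_classical all_reals all_analysis.
From mathcomp Require Import measurable_realfun ring lra zify.

Set Implicit Arguments.
Unset Strict Implicit.
Unset Printing Implicit Defensive.
Import Order.TTheory GRing.Theory Num.Theory.
Import numFieldNormedType.Exports.
Local Open Scope classical_set_scope.
Local Open Scope ring_scope.

(** Put [q = p / 2], so [1 < q < 2], and [t = <v, w>] for unit vectors [v] and
    [w]; then [|v - w|^p = 2^q (1 - t)^q].  In the binomial series
    [(1 - t)^q = \sum_k c_k t^k] all coefficients with [k >= 2] are positive
    ([binomial_coef_gt0]): passing from [c_k] to [c_(k+1)] multiplies by
    [(k - q) / (k + 1)], which is positive as soon as [k >= 2], and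
    [c_2 = q (q - 1) / 2].

    Expanding [<v, w>^k] over words of length [k] in the coordinates turns the
    double integral of [<v, w>^k] for two measures [mu], [nu] into the scalar
    product of their vectors of moments of order [k]
    ([mutual_energy_pow]).  For the uniform measure [sigma], the potential
    [\int <v, w>^k dsigma(w)] does not depend on the unit vector [v], because
    [sigma] is invariant under reflections and two unit vectors are always
    exchanged by one of them ([uniform_potential_cst]).  Hence the [mu]-[sigma]
    and [sigma]-[sigma] integrals of [<v, w>^k] coincide, and the [mu]-[mu]
    integral exceeds them by the sum of the squares of the differences of the
    moments of order [k] ([mutual_energy_pow_gap]).  This gap is
    nonnegative; it vanishes for [k = 0], and for [k = 1] when [mu] is centered,
    so the coefficient [c_1 = - q] does no harm.  Summing over [k],
    the excess of energy of a centered [mu] over [sigma] dominates a positive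
    multiple of its gap of any order [k >= 2] ([energy_gap]).

    So [sigma] is a minimizer, and a minimizer has the same moments as [sigma],
    hence equals [sigma], since the joint law of finitely many bounded functions
    is determined by its moments ([moments_determine]).

    Two points need work beyond this computation.  The series is expanded only
    for [|t| < 1], so the kernel [(1 - r t)^q] is treated first and [r] tends
    to [1] afterwards ([energy_kernel_dilated_power], [energy_kernel_power]).
    And the uniform measure is the normalized Hausdorff measure, so the area of
    the sphere has to be shown positive ([surface_setT_gt0], by projecting onto
    a cube) and finite ([surface_setT_lty], by an explicit grid). *)

(** * Coverings of the unit cube by boxes *)

(** Induction on [d] reduces this to integrals over the line: the slices of the
    boxes at height [y] cover a cube of one dimension less, and the resulting
    inequality is integrated over [y].  The weights [w] serve to discard the boxes
    that do not meet the slice, so the induction needs them. *)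
Lemma box_cover_volume (R : realType) (d : nat) (w : nat -> R)
    (a b : nat -> nat -> R) :
  (forall k, 0 <= w k) -> (forall k j, a k j <= b k j) ->
  (forall x : nat -> R, (forall j, 0 <= x j <= 1) ->
    (1 <= \sum_(k <oo)
       (w k * \prod_(j < d) \1_[set` `[a k j, b k j]] (x j))%:E)%E) ->
  (1 <= \sum_(k <oo) (w k * \prod_(j < d) (b k j - a k j))%:E)%E.
Proof.
elim: d w => [|d IHd] w w0 ab covw.
  have := covw (fun=> 0); under eq_eseriesr do rewrite big_ord0.
  under [X in _ -> (_ <= X)%E]eq_eseriesr do rewrite big_ord0.
  by apply => j; rewrite lexx ler01.
pose I k : set R := [set` `[a k d, b k d]].
have mI k : @measurable _ (measurableTypeR R) (I k) by exact: measurable_itv.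
have m01 : @measurable _ (measurableTypeR R) [set` `[0, 1]].
  exact: measurable_itv.
have mind k (D : set (measurableTypeR R)) :
    measurable_fun D (fun y : measurableTypeR R => (\1_(I k) y : R)%:E).
  apply/measurable_EFinP.
  exact: (measurable_indic (T := measurableTypeR R)).
pose c k : R := w k * \prod_(j < d) (b k j - a k j).
have c0 k : 0 <= c k.
  by apply: mulr_ge0 => //; apply: prodr_ge0 => j _; rewrite subr_ge0.
have slice y : 0 <= y <= 1 ->
    (1 <= \sum_(k <oo) ((c k)%:E * (\1_(I k) y)%:E))%E.
  move=> y01.
  have := IHd (fun k => w k * \1_(I k) y).
  under [X in _ -> _ -> _ -> (_ <= X)%E]eq_eseriesr => k _ do
    rewrite -mulrA [X in _ * X]mulrC mulrA EFinM.
  apply => // [k|x x01]; first by rewrite mulr_ge0.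
  have := covw (fun j => if (j < d)%N then x j else y).
  set S := (X in (_ <= X)%E); set S' := (X in _ -> (_ <= X)%E).
  suff -> : S = S' by apply => j; case: ifP.
  apply: eq_eseriesr => k _; congr (_%:E); rewrite big_ord_recr/= ltnn.
  rewrite [_ * \1__ _]mulrC mulrA; congr (_ * _).
  by apply: eq_bigr => j _; rewrite ltn_ord.
apply: (@le_trans _ _
    (\int[lebesgue_measure]_(y in [set` `[0%R, 1%R]])
       \sum_(k <oo) ((c k)%:E * (\1_(I k) y)%:E))%E).
  have <- : (\int[@lebesgue_measure R]_(y in [set` `[0%R, 1%R]])
      (cst 1 y) = 1)%E.
    rewrite integral_cst// mul1e; apply: eq_trans (lebesgue_measure_itv _) _.
    by rewrite /= lte01 sube0.
  apply: ge0_le_integral => //.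
    apply: ge0_emeasurable_sum => [k y _ _|k _].
      by rewrite mule_ge0// lee_fin.
    exact: measurable_funeM.
rewrite integral_nneseries//; last 2 first.
- by move=> k; apply: measurable_funTS; apply: measurable_funeM;
    exact/measurable_EFinP/measurable_indic.
- by move=> k y _; rewrite mule_ge0// lee_fin.
apply: lee_nneseries => [k _ _|k _].
  by apply: integral_ge0 => y _; rewrite mule_ge0// lee_fin.
rewrite ge0_integralZl_EFin//.
rewrite integral_indic// big_ord_recr/= mulrA [in leRHS]EFinM.
apply: lee_wpmul2l; first by rewrite lee_fin.
apply: (@le_trans _ _ (lebesgue_measure (I k))).
  by apply: le_measure; rewrite ?inE//; exact: measurableI.
rewrite /I; apply: (le_trans (_ : _ <= _)%E (lexx _)).
have := lebesgue_measure_itv `[a k d, b k d]; rewrite /= => ->.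
by case: ifP => // _; rewrite lee_fin subr_ge0.
Qed.

(** * The area of the sphere is positive and finite *)

Lemma normr_eucl_coord (R : realType) m (v : 'rV[R]_m) i :
  `|v 0 i| <= eucl_norm v.
Proof.
rewrite -sqrtr_sqr ler_wsqrtr// (bigD1 i)//= lerDl.
by apply: sumr_ge0 => k _; exact: sqr_ge0.
Qed.

Lemma eucl_norm_le_sum (R : realType) m (v : 'rV[R]_m) :
  eucl_norm v <= \sum_i `|v 0 i|.
Proof.
have s0 : 0 <= \sum_i `|v 0 i| by apply: sumr_ge0.
rewrite -[leRHS]ger0_norm// -sqrtr_sqr ler_wsqrtr//.
rewrite [leRHS]expr2 mulr_suml; apply: ler_sum => i _.
rewrite -real_normK ?num_real// expr2 ler_wpM2l//.
by rewrite (bigD1 i)//= lerDl sumr_ge0.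
Qed.

Lemma eucl_dist_ge0 (R : realType) m (v w : 'rV[R]_m) : 0 <= eucl_dist v w.
Proof. exact: sqrtr_ge0. Qed.

Lemma sum_sqr_sphere_val (R : realType) d (v : usphere R d) :
  \sum_i sphere_val v 0 i ^+ 2 = 1.
Proof.
have /set_mem : sval v \in @sphere R d by exact: valP v.
rewrite /sphere/= /eucl_norm => v1.
rewrite -[LHS]sqr_sqrtr; first by rewrite -[sphere_val v]/(sval v) v1 expr1n.
by apply: sumr_ge0 => i _; exact: sqr_ge0.
Qed.

Lemma sphere_coord_le1 (R : realType) d (v : usphere R d) i :
  `|sphere_val v 0 i| <= 1.
Proof.
apply: le_trans (normr_eucl_coord _ i) _.
by rewrite /eucl_norm sum_sqr_sphere_val sqrtr1.
Qed.

Lemma exists_sphere_val (R : realType) d (x : 'rV[R]_d.+1) :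
  \sum_i x 0 i ^+ 2 = 1 -> exists v : usphere R d, sphere_val v = x.
Proof.
move=> x1; have sx : @sphere R d x by rewrite /sphere/= /eucl_norm x1 sqrtr1.
by exists (SigSub (mem_set sx)).
Qed.

Lemma sphere_val_inj (R : realType) d : injective (@sphere_val R d).
Proof. exact: val_inj. Qed.

Lemma term_le_nneseries (R : realType) (u : nat -> \bar R) k :
  (forall n, 0 <= u n)%E -> (u k <= \sum_(n <oo) u n)%E.
Proof.
move=> u0; apply: le_trans (nneseries_lim_ge k.+1 _) => //.
by rewrite big_nat_recr//= leeDr// sume_ge0.
Qed.

(** With [c = 1 / d], the graph of [x |-> sqrt (1 - |c x|^2)] over the unit cube
    lies on the sphere, and a set of diameter [r] meeting it projects into a box
    of side [2 r / c] of the cube. *)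
Lemma surface_setT_gt0 (R : realType) (d : nat) :
  (0 < d)%N -> (0 < surface [set: usphere R d])%E.
Proof.
move=> d0; have [c c0 cd1] : exists2 c : R, 0 < c & c * d%:R = 1.
  by exists d%:R^-1; rewrite ?invr_gt0 ?ltr0n// mulVf// pnatr_eq0 -lt0n.
suff H : (1 <= ((2 / c) ^+ d)%:E * hausdorff_delta (@eucl_dist R d.+1) d%:R 1
    (@sphere_val R d @` setT))%E.
  apply: lt_le_trans (hausdorff_delta_le _ _ _ (@ltr01 R)).
  rewrite lt0e hausdorff_delta_ge0 andbT; apply/eqP => h0.
  by move: H; rewrite h0 mule0 lee_fin ler10.
rewrite muleC -lee_pdivrMr ?exprn_gt0 ?divr_gt0//.
apply: le_ereal_inf_tmp => _ [U [dU covU] <-].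
rewrite lee_pdivrMr ?exprn_gt0 ?divr_gt0// muleC.
(* The weight, centre and radius of the box attached to [U k]; empty sets get
   weight 0. *)
have /choice[D HD] k : exists D : R * 'rV[R]_d.+1 * R,
    [/\ 0 <= D.1.1, 0 <= D.2,
      hgauge (@eucl_dist R d.+1) d%:R (U k) = (D.1.1 * D.2 ^+ d)%:E &
      forall x, U k x -> D.1.1 = 1 /\ forall i, `|x 0 i - D.1.2 0 i| <= D.2].
  have [U0|/set0P[z Uz]] := eqVneq (U k) set0.
    by exists (0, 0, 0); split => //=; [rewrite U0 hgauge0 mul0r|rewrite U0].
  have dist_le x y : U k x -> U k y ->
      ((eucl_dist x y)%:E <= diam (@eucl_dist R d.+1) (U k))%E.
    by move=> Ux Uy; apply: ereal_sup_ubound; exists x, y.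
  have diamE : diam (@eucl_dist R d.+1) (U k) =
      (fine (diam (@eucl_dist R d.+1) (U k)))%:E.
    rewrite fineK// fin_numElt (lt_le_trans _ (dist_le _ _ Uz Uz)) ?ltNyr//=.
    by rewrite (le_lt_trans (dU k)) ?ltry.
  set r := fine _ in diamE.
  have r0 : 0 <= r.
    by rewrite -lee_fin -diamE (le_trans _ (dist_le _ _ Uz Uz))// lee_fin
      eucl_dist_ge0.
  exists (1, z, r); split => //=.
    rewrite /hgauge diamE mul1r; case: eqP => [U0|_].
      by move: Uz; rewrite U0.
    by rewrite poweR_EFin powR_mulrn.
  move=> x Ux; split=> // i; rewrite -lee_fin -diamE.
  apply: le_trans (dist_le x z Ux Uz); rewrite lee_fin.
  by have := normr_eucl_coord (x - z) i; rewrite !mxE.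
pose w k := (D k).1.1.
pose a k j := ((D k).1.2 0 (inord j.+1) - (D k).2) / c.
pose b k j := ((D k).1.2 0 (inord j.+1) + (D k).2) / c.
have ab k j : a k j <= b k j.
  have [_ r0 _ _] := HD k.
  by rewrite /a /b ler_pM2r ?invr_gt0//; lra.
have w0 k : 0 <= w k by have [] := HD k.
have /(_ d) := box_cover_volume w0 ab.
rewrite -nneseriesZl; last by move=> i _; exact: hgauge_ge0.
set S := (X in _ -> (_ <= X)%E); set S' := (X in (_ <= X)%E).
have -> : S = S'.
  apply: eq_eseriesr => k _; have [_ _ -> _] := HD k.
  rewrite -EFinM; congr (_%:E); rewrite -/(w k) mulrCA -exprMn.
  rewrite -[X in _ ^+ X](card_ord d) -prodr_const; congr (_ * _).
  apply: eq_bigr => j _; rewrite /b /a; ring.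
apply => x x01.
pose y : 'rV[R]_d.+1 := \row_i (if i == ord0 then
  Num.sqrt (1 - \sum_(j < d) (c * x j) ^+ 2) else c * x i.-1).
have ysmall : \sum_(j < d) (c * x j) ^+ 2 <= 1.
  apply: (@le_trans _ _ (\sum_(j < d) c)); last first.
    by rewrite sumr_const card_ord -mulr_natr cd1.
  apply: ler_sum => j _; have /andP[xj0 xj1] := x01 j.
  have c1 : c <= 1 by rewrite -cd1 ler_peMr ?ler1n// ltW.
  have cx0 : 0 <= c * x j by rewrite mulr_ge0// ltW.
  have cxc : c * x j <= c by rewrite ler_piMr// ltW.
  by rewrite expr2 (le_trans _ cxc)// ler_piMr// (le_trans cxc).
have [v vy] : exists v : usphere R d, sphere_val v = y.
  apply: exists_sphere_val.
  rewrite big_ord_recl !mxE eqxx sqr_sqrtr ?subr_ge0//.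
  under [X in _ + X]eq_bigr do rewrite !mxE/= add0n.
  by rewrite subrK.
have [k _ Uky] : (\bigcup_k U k) y by apply: covU; exists v.
apply: (@le_trans _ _
    (w k * \prod_(j < d) \1_([set` `[a k j, b k j]]) (x j))%:E); last first.
  apply: (@term_le_nneseries R (fun k =>
    (w k * \prod_(j < d) \1_([set` `[a k j, b k j]]) (x j))%:E)) => n.
  by rewrite lee_fin mulr_ge0// prodr_ge0.
have [_ _ _ /(_ _ Uky)[wk yD]] := HD k.
rewrite /w wk mul1r big1// => j _.
rewrite indicE mem_set//= in_itv/=.
have := yD (inord j.+1); rewrite mxE -val_eqE/= inordK ?ltnS ?ltn_ord//=.
rewrite ler_norml => /andP[h1 h2]; rewrite /a /b ler_pdivrMr// ler_pdivlMr//.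
by apply/andP; split; lra.
Qed.

Lemma hausdorff_delta_finite_cover (R : realType) (m s : nat) (I : finType)
    (V : I -> set 'rV[R]_m) (A : set 'rV[R]_m) (r delta : R) :
  0 <= r -> r <= delta ->
  (forall i x y, V i x -> V i y -> eucl_dist x y <= r) ->
  A `<=` \bigcup_i V i ->
  (hausdorff_delta (@eucl_dist R m) s%:R delta A <= (#|I|%:R * r ^+ s)%:E)%E.
Proof.
move=> r0 rdelta Vr AV.
pose U n := if insub n : option 'I_#|I| is Some i then V (enum_val i) else set0.
have UN n (I_n : (#|I| <= n)%N) : U n = set0.
  by rewrite /U insubF// ltnNge I_n.
have diamU n : (diam (@eucl_dist R m) (U n) <= r%:E)%E.
  apply: ge_ereal_sup => _ [x [y [Ux Uy ->]]]; rewrite lee_fin.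
  by move: Ux Uy; rewrite /U; case: insubP => // i _ _; exact: Vr.
have gaugeU n : (hgauge (@eucl_dist R m) s%:R (U n) <= (r ^+ s)%:E)%E.
  rewrite /hgauge; case: eqVneq => [_|/set0P[x Ux]].
    by rewrite lee_fin exprn_ge0.
  have : ((eucl_dist x x)%:E <= diam (@eucl_dist R m) (U n))%E.
    by apply: ereal_sup_ubound; exists x, x.
  move: (diamU n); case: (diam _ _) => [q| |]//=.
  rewrite !lee_fin => qr xxq; rewrite powR_mulrn ?lerXn2r ?nnegrE//.
  - exact: le_trans (eucl_dist_ge0 _ _) xxq.
  - exact: le_trans (eucl_dist_ge0 _ _) xxq.
apply: (@le_trans _ _ (\sum_(n <oo) hgauge (@eucl_dist R m) s%:R (U n))%E).
  apply: ereal_inf_lbound; exists U => //; split=> [n|x /AV[i _ Vix]].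
    by apply: le_trans (diamU n) _; rewrite lee_fin.
  exists (enum_rank i : nat) => //.
  by rewrite /U valK enum_rankK.
rewrite (nneseries_split 0 #|I|); last by move=> n _; exact: hgauge_ge0.
rewrite [X in (_ + X)%E]eseries0 ?adde0; last first.
  by move=> n In _; rewrite UN// hgauge0.
apply: (@le_trans _ _ (\sum_(0 <= n < #|I|) (r ^+ s)%:E)%E).
  by rewrite add0n; apply: lee_sum => n _.
by rewrite sumEFin sumr_const_nat subn0 mulr_natl.
Qed.

(** Where the [i]-th coordinate dominates, it is a Lipschitz function of the
    others, so a grid of mesh [1/N] in the other [d] coordinates cuts the sphere
    into pieces of diameter of order [1/N]. *)
Lemma sphere_patch_dist (R : realType) (d N : nat) (i : 'I_d.+1) (e : bool)
    (g : 'I_d -> nat) (v w : usphere R d) :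
  (0 < N)%N ->
  (forall x, x = v \/ x = w ->
    [/\ d.+1%:R^-1 <= (-1) ^+ e * sphere_val x 0 i
      & forall j, (g j)%:R <= (sphere_val x 0 (lift i j) + 1) * N%:R <=
          (g j).+1%:R]) ->
  eucl_dist (sphere_val v) (sphere_val w) <= (d * d.+2)%:R / N%:R.
Proof.
move=> N0 H.
have N0' : 0 < N%:R :> R by rewrite ltr0n.
have [vi vg] := H v (or_introl erefl); have [wi wg] := H w (or_intror erefl).
set x := sphere_val v in vi vg *; set y := sphere_val w in wi wg *.
have xyj j : `|x 0 (lift i j) - y 0 (lift i j)| <= N%:R^-1.
  have /andP[v1 v2] := vg j; have /andP[w1 w2] := wg j.
  rewrite -[leRHS]div1r ler_pdivlMr// -[N%:R in leLHS](ger0_norm (ltW N0')).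
  by rewrite -normrM ler_norml; rewrite -natr1 in v2 w2; apply/andP; split; lra.
have bigE (F : 'I_d.+1 -> R) : \sum_k F k = F i + \sum_j F (lift i j).
  rewrite (bigD1_ord i)//=.
(* [(x_i - y_i) (x_i + y_i)] is controlled by the other coordinates since [x] and
   [y] are unit vectors, and [x_i + y_i] is bounded away from 0. *)
have sqrD : x 0 i ^+ 2 - y 0 i ^+ 2 =
    - \sum_j (x 0 (lift i j) ^+ 2 - y 0 (lift i j) ^+ 2).
  have := sum_sqr_sphere_val v; have := sum_sqr_sphere_val w.
  rewrite !bigE sumrB -/x -/y => h1 h2; lra.
have sqrle : `|x 0 i ^+ 2 - y 0 i ^+ 2| <= d%:R * (2 / N%:R).
  rewrite sqrD normrN; apply: le_trans (ler_norm_sum _ _ _) _.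
  rewrite mulr_natl -[X in _ *+ X](card_ord d) -sumr_const.
  apply: ler_sum => j _; rewrite subr_sqr normrM mulrC; apply: ler_pM => //.
  apply: le_trans (ler_normD _ _) _.
  have := sphere_coord_le1 v (lift i j); have := sphere_coord_le1 w (lift i j).
  by rewrite -/x -/y; lra.
have xyi : `|x 0 i - y 0 i| <= (d * d.+1)%:R / N%:R.
  have sg : `|x 0 i + y 0 i| = (-1) ^+ e * x 0 i + (-1) ^+ e * y 0 i.
    rewrite -mulrDr -[RHS]ger0_norm ?normrM ?normrX ?normrN1 ?expr1n ?mul1r//.
    by rewrite mulrDr addr_ge0//; [apply: le_trans vi|apply: le_trans wi].
  have lb : 2 / d.+1%:R <= `|x 0 i + y 0 i|.
    by rewrite sg mulr_natl mulr2n lerD.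
  have : `|x 0 i - y 0 i| * (2 / d.+1%:R) <= d%:R * (2 / N%:R).
    apply: le_trans sqrle; rewrite subr_sqr normrM; exact: ler_wpM2l.
  rewrite [leLHS]mulrA ler_pdivrMr ?ltr0n// natrM.
  set D := d.+1%:R; set n := N%:R^-1; rewrite -/n => h.
  have -> : d%:R * D * n = (d%:R * (2 * n) * D) / 2 by field.
  by rewrite ler_pdivlMr.
rewrite /eucl_dist (le_trans (eucl_norm_le_sum _))// bigE.
have -> : (d * d.+2)%:R / N%:R = (d * d.+1)%:R / N%:R + d%:R / N%:R :> R.
  by rewrite -mulrDl -natrD; congr (_%:R / _); rewrite mulnS addnC.
apply: lerD; first by rewrite !mxE.
rewrite mulr_natl -[X in _ *+ X](card_ord d) -sumr_const.
by apply: ler_sum => j _; rewrite !mxE.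
Qed.

(** The number [2 (d+1) (2N+1)^d] of patches of mesh [1/N] times the [d]-th power
    of their diameter stays bounded as [N] grows. *)
Lemma surface_setT_lty (R : realType) (d : nat) :
  (surface [set: usphere R d] < +oo)%E.
Proof.
pose C : R := (d.+1 * 2)%:R * (3 * (d * d.+2))%:R ^+ d.
apply: (@le_lt_trans _ _ C%:E); last exact: ltry.
apply: ge_ereal_sup => _ [delta /= delta0 <-].
pose K : R := (d * d.+2)%:R.
have [N N0 KN] : exists2 N, (0 < N)%N & K / N%:R <= delta.
  exists (Num.trunc (K / delta)).+1 => //.
  have Kd : 0 <= K / delta by rewrite divr_ge0 ?ler0n// ltW.
  have /andP[_ /ltW] := truncn_itv Kd.
  by rewrite ler_pdivrMr// mulrC => h; rewrite ler_pdivrMr ?ltr0n.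
(* A patch is labelled by the dominant coordinate, its sign, and the cells of the
   other coordinates in a subdivision of [-1, 1] of mesh [1/N]. *)
pose I := ('I_d.+1 * bool * {ffun 'I_d -> 'I_(2 * N).+1})%type.
pose V (l : I) : set 'rV[R]_d.+1 := [set x | (range (@sphere_val R d)) x /\
  [/\ d.+1%:R^-1 <= (-1) ^+ l.1.2 * x 0 l.1.1
      & forall j, (l.2 j)%:R <= (x 0 (lift l.1.1 j) + 1) * N%:R <=
          (l.2 j).+1%:R]].
have := @hausdorff_delta_finite_cover R d.+1 d I V (range (@sphere_val R d))
  (K / N%:R) delta.
have -> : @sphere_val R d @` setT = range (@sphere_val R d) by [].
move=> H; apply: (le_trans (H _ KN _ _)).
- by rewrite divr_ge0.
- move=> l _ _ [[v _ <-] lv] [[w _ <-] lw].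
  apply: (@sphere_patch_dist R d N l.1.1 l.1.2 (fun j => l.2 j)) => //.
  by move=> x [->|->].
- move=> _ [v _ <-]; set x := sphere_val v.
  have [i xi] : exists i, d.+1%:R^-1 <= x 0 i ^+ 2.
    apply: contrapT => /forallNP h.
    have : \sum_i x 0 i ^+ 2 < \sum_(i < d.+1) d.+1%:R^-1 :> R.
      apply: ltr_sum => [|i _].
        by apply/hasP; exists ord0; rewrite ?mem_index_enum.
      by rewrite ltNge; apply/negP; exact: h.
    rewrite sum_sqr_sphere_val sumr_const card_ord.
    by rewrite -[ltRHS]mulr_natr mulVf ?ltxx.
  have coord1 j : `|x 0 j| <= 1 by exact: sphere_coord_le1.
  have pos j : 0 <= (x 0 j + 1) * N%:R.
    have := coord1 j; rewrite ler_norml => /andP[? _].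
    by apply: mulr_ge0 => //; lra.
  exists (i, x 0 i < 0,
    [ffun j => inord (Num.trunc ((x 0 (lift i j) + 1) * N%:R))]) => //.
  split; first by exists v.
  split => [/=|j /=].
    have -> : (-1) ^+ (x 0 i < 0)%R * x 0 i = `|x 0 i|.
      case: (ltP (x 0 i) 0) => xi0.
        by rewrite expr1 mulN1r ltr0_norm.
      by rewrite expr0 mul1r ger0_norm.
    apply: le_trans xi _; rewrite -real_normK ?num_real// expr2.
    by rewrite ler_piMr.
  have /andP[t1 t2] := truncn_itv (pos (lift i j)).
  rewrite ffunE inordK ?t1 ?ltW//.
  rewrite ltnS -(ler_nat R) (le_trans t1)// natrM ler_wpM2r//.
  by have := coord1 (lift i j); rewrite ler_norml => /andP[_ ?]; lra.
rewrite lee_fin !card_prod card_ffun !card_ord card_bool /C.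
rewrite natrM -mulrA ler_wpM2l// natrX -exprMn lerXn2r ?nnegrE//.
  by rewrite mulr_ge0// divr_ge0.
rewrite natrM -/K mulrA ler_pdivrMr ?ltr0n// mulrAC ler_wpM2r//.
by rewrite -natrM ler_nat; lia.
Qed.

(** * Integration of bounded measurable functions *)

Section bounded_measurable.
Context {R : realType} {disp : measure_display} {T : measurableType disp}.
Implicit Types (f g : T -> R) (mu nu : probability T R).

Definition bounded_measurable f :=
  measurable_fun setT f /\ exists C, forall x, `|f x| <= C.

Lemma bounded_measurable_cst (c : R) : bounded_measurable (fun=> c).
Proof. by split; [exact: measurable_cst|exists `|c|]. Qed.

Lemma bounded_measurableD f g : bounded_measurable f -> bounded_measurable g ->
  bounded_measurable (fun x => f x + g x).
Proof.
move=> [mf [C fC]] [mg [D gD]]; split; first exact: measurable_funD.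
by exists (C + D) => x; rewrite (le_trans (ler_normD _ _))// lerD.
Qed.

Lemma bounded_measurableM f g : bounded_measurable f -> bounded_measurable g ->
  bounded_measurable (fun x => f x * g x).
Proof.
move=> [mf [C fC]] [mg [D gD]]; split; first exact: measurable_funM.
by exists (C * D) => x; rewrite normrM ler_pM.
Qed.

Lemma bounded_measurable_sum (I : Type) (s : seq I) (F : I -> T -> R) :
  (forall i, bounded_measurable (F i)) ->
  bounded_measurable (fun x => \sum_(i <- s) F i x).
Proof.
move=> mF; elim: s => [|i s IHs].
  under eq_fun do rewrite big_nil; exact: bounded_measurable_cst.
by under eq_fun do rewrite big_cons; exact: bounded_measurableD.
Qed.

Lemma bounded_measurable_prod (I : Type) (s : seq I) (F : I -> T -> R) :
  (forall i, bounded_measurable (F i)) ->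
  bounded_measurable (fun x => \prod_(i <- s) F i x).
Proof.
move=> mF; elim: s => [|i s IHs].
  under eq_fun do rewrite big_nil; exact: bounded_measurable_cst.
by under eq_fun do rewrite big_cons; exact: bounded_measurableM.
Qed.

Lemma bounded_measurable_integrable mu f : bounded_measurable f ->
  mu.-integrable setT (EFin \o f).
Proof.
move=> [mf [C fC]]; apply: measurable_bounded_integrable => //.
  by rewrite (le_lt_trans (probability_le1 mu measurableT))// ltry.
by exists C; split; [exact: num_real|move=> x /ltW Cx y _; exact: le_trans Cx].
Qed.

Lemma Rintegral_probability_cst mu (c : R) : \int[mu]_x c = c.
Proof. by rewrite Rintegral_cst//= (probability_setT mu)/= mulr1. Qed.

Lemma bounded_RintegralD mu f g :
  bounded_measurable f -> bounded_measurable g ->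
  \int[mu]_x (f x + g x) = \int[mu]_x f x + \int[mu]_x g x.
Proof.
by move=> mf mg; apply: RintegralD => //; exact: bounded_measurable_integrable.
Qed.

Lemma bounded_RintegralZl mu (c : R) f : bounded_measurable f ->
  \int[mu]_x (c * f x) = c * \int[mu]_x f x.
Proof.
by move=> mf; apply: RintegralZl => //; exact: bounded_measurable_integrable.
Qed.

Lemma bounded_Rintegral_sum mu (I : Type) (s : seq I) (F : I -> T -> R) :
  (forall i, bounded_measurable (F i)) ->
  \int[mu]_x (\sum_(i <- s) F i x) = \sum_(i <- s) \int[mu]_x F i x.
Proof.
move=> mF; elim: s => [|i s IHs].
  rewrite big_nil -[RHS](Rintegral_probability_cst mu).
  by apply: eq_Rintegral => x _; rewrite big_nil.
rewrite big_cons -IHs -bounded_RintegralD//; last exact: bounded_measurable_sum.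
by apply: eq_Rintegral => x _; rewrite big_cons.
Qed.

Lemma bounded_Rintegral_le mu f (C : R) : bounded_measurable f ->
  (forall x, `|f x| <= C) -> `|\int[mu]_x f x| <= C.
Proof.
move=> mf fC; have imf := bounded_measurable_integrable mu mf.
apply: le_trans (le_normr_Rintegral _ imf) _ => //.
rewrite -[leRHS](Rintegral_probability_cst mu); apply: le_Rintegral => //.
- by apply: (bounded_measurable_integrable mu (f := fun x => `|f x|)); split;
    [apply: measurableT_comp => //; case: mf|exists C => x; rewrite normr_id].
- exact: (bounded_measurable_integrable mu (bounded_measurable_cst C)).
Qed.

Lemma bounded_measurable_cvg (F : nat -> T -> R) f (C : R) :
  (forall n, measurable_fun setT (F n)) -> (forall n x, `|F n x| <= C) ->
  (forall x, F n x @[n --> \oo] --> f x) -> bounded_measurable f.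
Proof.
move=> mF FC Ff; split; first exact: (measurable_fun_cvg mF).
exists C => x; have Fx : `|F n x| @[n --> \oo] --> `|f x|.
  exact: cvg_norm (Ff x).
rewrite -(cvg_lim (@Rhausdorff R) Fx); apply: limr_le.
  by apply/cvg_ex; exists `|f x|.
by apply: nearW => n; exact: FC.
Qed.

Lemma bounded_Rintegral_cvg mu (F : nat -> T -> R) f (C : R) :
  (forall n, measurable_fun setT (F n)) -> (forall n x, `|F n x| <= C) ->
  (forall x, F n x @[n --> \oo] --> f x) ->
  \int[mu]_x F n x @[n --> \oo] --> \int[mu]_x f x.
Proof.
move=> mF FC Ff; have [mf _] := bounded_measurable_cvg mF FC Ff.
have [] := @dominated_convergence _ T R mu setT measurableT
  (fun n x => (F n x)%:E) (EFin \o f) (cst C%:E).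
- by move=> n; exact/measurable_EFinP.
- exact/measurable_EFinP.
- by apply: aeW => x _; apply: cvg_EFin; [exact: nearW|exact: Ff].
- exact: (bounded_measurable_integrable mu (bounded_measurable_cst C)).
- by apply: aeW => x n _; rewrite /= lee_fin.
move=> iF _; move=> cv; apply: fine_cvg.
suff -> : (fine (\int[mu]_x (f x)%:E)%E)%:E = (\int[mu]_x (f x)%:E)%E by [].
rewrite fineK//; exact: integrable_fin_num.
Qed.

End bounded_measurable.

(** * The Borel sets of the sphere *)

Definition half_spheres (R : realType) d : set (set (usphere R d)) :=
  [set A | exists i a, A = [set v | a < sphere_val v 0 i]].

(** An open set of the ambient space is the union of the countably many rational
    half-open boxes that it contains. *)
Lemma measurable_usphere_half_spheres (R : realType) d (A : set (usphere R d)) :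
  measurable A -> <<s @half_spheres R d >> A.
Proof.
apply: smallest_sub; first exact: smallest_sigma_algebra.
move=> _ [W oW <-].
pose T := g_sigma_algebraType (@half_spheres R d).
suff : @measurable _ T (@sphere_val R d @^-1` W) by [].
pose box (ab : 'rV[rat]_d.+1 * 'rV[rat]_d.+1) : set 'rV[R]_d.+1 :=
  [set x | forall i, ratr (ab.1 0 i) < x 0 i <= ratr (ab.2 0 i)].
have mhalf i a : @measurable _ T [set v | a < sphere_val v 0 i].
  by apply: sub_sigma_algebra; exists i, a.
have mbox ab : @measurable _ T (@sphere_val R d @^-1` box ab).
  have -> : @sphere_val R d @^-1` box ab = \bigcap_(i in [set: 'I_d.+1])
      ([set v | ratr (ab.1 0 i) < sphere_val v 0 i] `\`
       [set v | ratr (ab.2 0 i) < sphere_val v 0 i]).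
    apply/seteqP; split=> [v vab i _|v vab i].
      have /andP[av vb] := vab i.
      by split => //=; apply/negP; rewrite -leNgt.
    by have [/= -> /negP] := vab i I; rewrite -leNgt.
  by apply: fin_bigcap_measurable => // i _; apply: measurableD; exact: mhalf.
pose F ab : set T := if `[< box ab `<=` W >] then @sphere_val R d @^-1` box ab
  else set0.
have -> : @sphere_val R d @^-1` W = \bigcup_ab F ab.
  apply/seteqP; split=> [v Wv|v [ab _]]; last first.
    by rewrite /F; case: asboolP => // abW /abW.
  have /nbhs_ballP[e /= e0 veW] : nbhs (sphere_val v) W.
    exact: open_nbhs_nbhs.
  have /choice[a Ha] (i : 'I_d.+1) : exists q : rat,
      sphere_val v 0 i - e < ratr q < sphere_val v 0 i.
    have [|q qv] := @rat_in_itvoo R (sphere_val v 0 i - e) (sphere_val v 0 i).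
      by rewrite ltrBlDr ltrDl.
    by exists q; rewrite in_itv/= in qv.
  have /choice[b Hb] (i : 'I_d.+1) : exists q : rat,
      sphere_val v 0 i < ratr q < sphere_val v 0 i + e.
    have [|q qv] := @rat_in_itvoo R (sphere_val v 0 i) (sphere_val v 0 i + e).
      by rewrite ltrDl.
    by exists q; rewrite in_itv/= in qv.
  exists (\row_i a i, \row_i b i) => //; rewrite /F; case: asboolP => [_ i|[]].
    rewrite !mxE; have /andP[_ ->] := Ha i.
    by have /andP[/ltW -> _] := Hb i.
  move=> x xab; apply: veW; split=> // i j; rewrite (ord1 i) -ball_normE/=.
  have /andP[a1 a2] := Ha j; have /andP[b1 b2] := Hb j.
  have := xab j; rewrite !mxE => /andP[x1 x2].
  by rewrite ltr_norml; apply/andP; split; lra.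
apply: countable_bigcupT_measurable => [|ab].
  exact: countableP.
by rewrite /F; case: asboolP => // _; exact: mbox.
Qed.

Lemma measurable_sphere_coord (R : realType) d i :
  measurable_fun [set: usphere R d] (fun v => sphere_val v 0 i).
Proof.
apply: (measurability _ (RGenOInfty.measurableE R)) => _ [_ [a ->] <-].
rewrite setTI; apply: sub_sigma_algebra.
exists [set x : 'rV[R]_d.+1 | a < x 0 i].
  apply: (@open_comp _ _ (fun x : 'rV[R]_d.+1 => x 0 i) [set r | a < r]);
    last exact: open_gt.
  by move=> x _; exact: coord_continuous.
by apply/seteqP; split => v /=; rewrite in_itv/= andbT.
Qed.

Lemma measurable_to_usphere (R : realType) d disp (T : measurableType disp)
    (f : T -> usphere R d) :
  (forall i, measurable_fun setT (fun x => sphere_val (f x) 0 i)) ->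
  measurable_fun setT f.
Proof.
move=> mf _ A mA; rewrite setTI.
apply: (smallest_sub _ _ (measurable_usphere_half_spheres mA)
  : [set A | measurable (f @^-1` A)] A).
  split => /= [|B mB|F mF].
  - by rewrite preimage_set0.
  - by rewrite setTD preimage_setC; exact: measurableC.
  - by rewrite preimage_bigcup; exact: bigcup_measurable.
move=> _ [i [a ->]] /=.
have := mf i measurableT _ (measurable_itv `]a, +oo[); rewrite setTI.
by congr measurable; apply/seteqP; split => x /=; rewrite in_itv/= andbT.
Qed.

(** * Reflections and the invariance of the uniform measure *)

Lemma hausdorff_isometry_image (R : realType) (T : Type) (dist : T -> T -> R)
    (s : R) (f : T -> T) (A : set T) :
  (forall x y, dist (f x) (f y) = dist x y) ->
  (hausdorff dist s (f @` A) <= hausdorff dist s A)%E.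
Proof.
move=> fd; have diamf U : diam dist (f @` U) = diam dist U.
  congr ereal_sup; apply/seteqP; split => z /=.
    by move=> [_ [_ [[x Ux <-] [y Uy <-] ->]]]; exists x, y; rewrite fd.
  move=> [x [y [Ux Uy ->]]]; exists (f x), (f y).
  by split; [exists x|exists y|rewrite fd].
apply: ge_ereal_sup => _ [delta /= delta0 <-].
apply: le_trans (hausdorff_delta_le dist s A delta0).
apply: le_ereal_inf_tmp => _ [U [dU AU] <-]; apply: ereal_inf_lbound.
exists (fun k => f @` U k).
  split=> [k|_ [x Ax <-]]; first by rewrite diamf.
  by have [k _ Ukx] := AU x Ax; exists k => //; exists x.
apply: eq_eseriesr => k _; rewrite /hgauge diamf.
by congr (if _ then _ else _); apply/eqP/eqP; [exact: image_set0_set0|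
  move=> ->; rewrite image_set0].
Qed.

Section reflection.
Context {R : realType}.

Definition dot m (x y : 'rV[R]_m) : R := \sum_i x 0 i * y 0 i.

Lemma dotC m (x y : 'rV[R]_m) : dot x y = dot y x.
Proof. by apply: eq_bigr => i _; rewrite mulrC. Qed.

Lemma dotDl m (x y z : 'rV[R]_m) : dot (x + y) z = dot x z + dot y z.
Proof. by rewrite -big_split; apply: eq_bigr => i _; rewrite mxE mulrDl. Qed.

Lemma dotZl m a (x y : 'rV[R]_m) : dot (a *: x) y = a * dot x y.
Proof. by rewrite mulr_sumr; apply: eq_bigr => i _; rewrite mxE mulrA. Qed.

Lemma dotBl m (x y z : 'rV[R]_m) : dot (x - y) z = dot x z - dot y z.
Proof. by rewrite dotDl -scaleN1r dotZl mulN1r. Qed.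

Lemma dot_eq0 m (x : 'rV[R]_m) : dot x x = 0 -> x = 0.
Proof.
move=> /eqP; rewrite psumr_eq0 => [/allP x0|i _]; last exact: sqr_ge0.
apply/rowP => i; rewrite mxE; apply/eqP.
by have := x0 i (mem_index_enum _); rewrite /= mulf_eq0 orbb.
Qed.

Lemma eucl_norm_dot m (x : 'rV[R]_m) : eucl_norm x = Num.sqrt (dot x x).
Proof. by []. Qed.

(** The reflection in the hyperplane orthogonal to [u]; it is the identity when
    [u = 0]. *)
Definition refl m (u x : 'rV[R]_m) : 'rV[R]_m :=
  x - (2 * dot x u / dot u u) *: u.

Lemma dot_refl m (u x y : 'rV[R]_m) : dot (refl u x) (refl u y) = dot x y.
Proof.
have [u0|u0] := eqVneq (dot u u) 0.
  by rewrite /refl u0 invr0 !mulr0 !scale0r !subr0.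
rewrite dotBl dotZl ![dot _ (refl u y)]dotC !dotBl !dotZl.
by rewrite [dot u x]dotC [dot y x]dotC; field.
Qed.

Lemma reflB m (u x y : 'rV[R]_m) : refl u (x - y) = refl u x - refl u y.
Proof.
rewrite /refl dotBl mulrBr mulrBl scalerBl.
by rewrite !opprB addrACA [RHS]addrACA; congr (_ + _); exact: addrC.
Qed.

Lemma eucl_dist_refl m (u x y : 'rV[R]_m) :
  eucl_dist (refl u x) (refl u y) = eucl_dist x y.
Proof. by rewrite /eucl_dist -reflB !eucl_norm_dot dot_refl. Qed.

Lemma reflK m (u : 'rV[R]_m) : involutive (refl u).
Proof.
move=> x; have [u0|u0] := eqVneq (dot u u) 0.
  by rewrite /refl u0 invr0 !mulr0 !scale0r !subr0.
rewrite {1}/refl; have -> : dot (refl u x) u = - dot x u.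
  by rewrite /refl dotBl dotZl; field.
by rewrite mulrN mulNr scaleNr opprK /refl subrK.
Qed.

(** Reflections act transitively on spheres. *)
Lemma refl_swap m (x y : 'rV[R]_m) : dot x x = dot y y -> refl (x - y) x = y.
Proof.
move=> xy; have [u0|u0] := eqVneq (dot (x - y) (x - y)) 0.
  have /eqP := dot_eq0 u0; rewrite subr_eq0 => /eqP ->.
  by rewrite /refl subrr scaler0 subr0.
rewrite /refl; suff -> : 2 * dot x (x - y) / dot (x - y) (x - y) = 1.
  by rewrite scale1r opprB addrC subrK.
apply: (canLR (mulfK u0)); rewrite mul1r.
rewrite [in RHS]dotBl ![dot _ (x - y)]dotC !dotBl [dot y x]dotC xy; ring.
Qed.

End reflection.

Section sphere_reflection.
Context {R : realType} {d : nat}.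
Implicit Types (u : 'rV[R]_d.+1) (v w : usphere R d).
Local Notation sigma := (uniform_sphere R d).

Lemma dot_sphere_val v : dot (sphere_val v) (sphere_val v) = 1.
Proof. exact: sum_sqr_sphere_val. Qed.

Lemma refl_sphere u v : @sphere R d (refl u (sphere_val v)).
Proof. by rewrite /sphere/= eucl_norm_dot dot_refl dot_sphere_val sqrtr1. Qed.

Definition sphere_refl u v : usphere R d := SigSub (mem_set (refl_sphere u v)).

Lemma sphere_reflE u v : sphere_val (sphere_refl u v) = refl u (sphere_val v).
Proof. by []. Qed.

Lemma sphere_reflK u : involutive (sphere_refl u).
Proof.
by move=> v; apply: sphere_val_inj; rewrite !sphere_reflE reflK.
Qed.

Lemma measurable_sphere_refl u : measurable_fun setT (sphere_refl u).
Proof.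
apply: measurable_to_usphere => i.
have -> : (fun v => sphere_val (sphere_refl u v) 0 i) = (fun v =>
    sphere_val v 0 i +
    \sum_j (- 2 / dot u u * u 0 i * u 0 j) * sphere_val v 0 j).
  apply/funext => v; rewrite sphere_reflE !mxE; congr (_ + _).
  rewrite [dot (sphere_val v) u]/dot mulr_sumr !mulr_suml -sumrN.
  by apply: eq_bigr => j _; ring.
apply: measurable_funD; first exact: measurable_sphere_coord.
apply: measurable_sum => j; apply: measurable_funM => //.
exact: measurable_sphere_coord.
Qed.

(** Isometries do not increase the area, and a reflection is its own inverse. *)
Lemma surface_sphere_refl u (A : set (usphere R d)) :
  surface (sphere_refl u @^-1` A) = surface A.
Proof.
have le (B : set (usphere R d)) :
    (surface (sphere_refl u @^-1` B) <= surface B)%E.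
  have imE : @sphere_val R d @` (sphere_refl u @^-1` B) =
      refl u @` (@sphere_val R d @` B).
    apply/seteqP; split => [_ [v Bv <-]|_ [_ [v Bv <-] <-]].
      exists (sphere_val (sphere_refl u v)); first by exists (sphere_refl u v).
      by rewrite sphere_reflE reflK.
    by exists (sphere_refl u v) => //=; rewrite sphere_reflK.
  rewrite /surface imE; apply: hausdorff_isometry_image.
  exact: eucl_dist_refl.
apply/eqP; rewrite eq_le le/=; apply: le_trans (le _).
rewrite -comp_preimage.
by have -> : sphere_refl u \o sphere_refl u = id by apply/funext/sphere_reflK.
Qed.

Lemma uniform_sphereE : (0 < d)%N -> forall A : set (usphere R d),
  sigma A = (surface A * ((fine (surface [set: usphere R d]))^-1)%:E)%E.
Proof.
move=> d0 A; rewrite /uniform_sphere /= /mnormalize.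
rewrite gt_eqF; last exact: surface_setT_gt0.
by rewrite lt_eqF//; exact: surface_setT_lty.
Qed.

Lemma uniform_sphere_refl u : (0 < d)%N -> forall A : set (usphere R d),
  sigma (sphere_refl u @^-1` A) = sigma A.
Proof. by move=> d0 A; rewrite !uniform_sphereE// surface_sphere_refl. Qed.

Lemma Rintegral_sphere_refl u (f : usphere R d -> R) : (0 < d)%N ->
  bounded_measurable f ->
  \int[sigma]_v f (sphere_refl u v) = \int[sigma]_v f v.
Proof.
move=> d0 mf; have mr := measurable_sphere_refl u.
have mfr : bounded_measurable (fun v => f (sphere_refl u v)).
  have [mf' [C fC]] := mf; split; last by exists C => v; exact: fC.
  exact: (measurableT_comp mf' mr).
rewrite /Rintegral; congr fine.
have := @integral_pushforward _ _ _ _ R (sphere_refl u) mr sigma setT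
  (EFin \o f).
rewrite preimage_setT => <- //; last 2 first.
- by apply/measurable_EFinP; case: mf.
- exact: (bounded_measurable_integrable sigma mfr).
by apply: eq_measure_integral => A mA _; exact: uniform_sphere_refl.
Qed.

Lemma bounded_measurable_coord i :
  bounded_measurable (fun v : usphere R d => sphere_val v 0 i).
Proof.
split; first exact: measurable_sphere_coord.
by exists 1 => v; exact: sphere_coord_le1.
Qed.

(** The reflection along the [i]-th axis changes the sign of the [i]-th
    coordinate. *)
Lemma uniform_sphere_centered : (0 < d)%N ->
  centered_probability (uniform_sphere R d).
Proof.
move=> d0; apply/rowP => i; rewrite !mxE.
pose e : 'rV[R]_d.+1 := delta_mx 0 i.
have dote (x : 'rV[R]_d.+1) : dot x e = x 0 i.
  rewrite /dot (bigD1 i)//= mxE !eqxx mulr1 big1 ?addr0// => j /negbTE ji.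
  by rewrite mxE ji andbF mulr0.
have := Rintegral_sphere_refl e d0 (bounded_measurable_coord i).
under eq_Rintegral => v _.
  rewrite sphere_reflE !mxE dote dote mxE !eqxx divr1 mulr1.
  rewrite (_ : _ - _ = - 1 * sphere_val v 0 i); last by ring.
  over.
rewrite bounded_RintegralZl ?mulN1r; last exact: bounded_measurable_coord.
by move=> h; lra.
Qed.

End sphere_reflection.

(** * The binomial series *)

Section binomial_series.
Context {R : realType}.
Implicit Types (s t K C : R).

(** The coefficient [(-1)^k] times [s] choose [k] of [t^k] in [(1 - t)^s]. *)
Fixpoint binomial_coef s (k : nat) : R :=
  if k is k'.+1 then binomial_coef s k' * (k'%:R - s) / k'.+1%:R else 1.

Lemma mul_binomial_coef s k :
  (k%:R - s) * binomial_coef s k = - s * binomial_coef (s - 1) k.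
Proof.
elim: k => [|k IHk] /=; first by rewrite sub0r.
transitivity ((k.+1%:R - s) / k.+1%:R * ((k%:R - s) * binomial_coef s k)).
  by ring.
by rewrite IHk -natr1; ring.
Qed.

(** The derivative of [(1 - t)^s] is [- s (1 - t)^(s - 1)], on coefficients. *)
Lemma pseries_diffs_binomial_coef s :
  pseries_diffs (binomial_coef s) = (fun k => - s * binomial_coef (s - 1) k).
Proof.
apply/funext => k; rewrite -mul_binomial_coef /pseries_diffs /=.
by rewrite mulrC divfK ?pnatr_eq0// mulrC.
Qed.

(** [(1 - t)^s = (1 - t) (1 - t)^(s - 1)], on coefficients. *)
Lemma binomial_coef_pascal s k :
  binomial_coef s k.+1 = binomial_coef (s - 1) k.+1 - binomial_coef (s - 1) k.
Proof.
have k1 : k.+1%:R != 0 :> R by rewrite pnatr_eq0.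
apply: (mulfI k1); rewrite -[LHS]/(pseries_diffs (binomial_coef s) k).
rewrite pseries_diffs_binomial_coef /= mulrBr mulrC.
by rewrite [k.+1%:R * (_ / _)]mulrC divfK// -natr1; ring.
Qed.

Lemma binomial_coef_le1 s k : -1 <= s <= 1 -> `|binomial_coef s k| <= 1.
Proof.
move=> /andP[s0 s1]; elim: k => [|k IHk] /=; first by rewrite normr1.
rewrite !normrM normfV [`|k.+1%:R|]ger0_norm// ler_pdivrMr ?ltr0n// mul1r.
rewrite -[leRHS]mul1r ler_pM// ler_norml -natr1.
have : 0 <= k%:R :> R by []. 
move=> k0; apply/andP; split; lra.
Qed.

Lemma is_cvg_pseries_bounded (f : R^nat) C K :
  (forall k, `|f k| <= C) -> 0 <= K < 1 -> cvgn (pseries f K).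
Proof.
move=> fC /andP[K0 K1]; apply: normed_cvg.
apply: (@series_le_cvg _ _ (geometric C K)) => [n|n|n|] /=; first by [].
- by rewrite /geometric/= mulr_ge0 ?exprn_ge0// (le_trans _ (fC 0%N)).
- by rewrite normrM normrX (ger0_norm K0) ler_wpM2r ?exprn_ge0.
- by apply: is_cvg_geometric_series; rewrite ger0_norm.
Qed.

Lemma derive0_unit_interval (f : R -> R) :
  (forall t, `|t| < 1 -> is_derive t 1 f 0) -> forall t, `|t| < 1 -> f t = f 0.
Proof.
move=> df t t1.
have cst a b : `|a| < 1 -> `|b| < 1 -> a <= b -> f b = f a.
  move=> a1 b1 ab.
  have inab x : x \in `[a, b]%R -> `|x| < 1.
    rewrite in_itv/= => /andP[ax xb]; move: a1 b1.
    rewrite !ltr_norml => /andP[a1 _] /andP[_ b1].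
    by rewrite (lt_le_trans a1)//= (le_lt_trans xb).
  have [| |c _] := @MVT_segment R f (fun=> 0) a b ab.
  - by move=> x /subset_itv_oo_cc/inab; exact: df.
  - by apply: derivable_within_continuous => x /inab/df[].
  - by rewrite mul0r => /eqP; rewrite subr_eq0 => /eqP.
have z1 : `|0 : R| < 1 by rewrite normr0.
by have [t0|/ltW t0] := leP 0 t; [exact: cst|apply/esym; exact: cst].
Qed.

(** Twice the bound for the exponent [s - 1], by Pascal's rule. *)
Lemma binomial_coef_le2 s k : 1 < s < 2 -> `|binomial_coef s k| <= 2.
Proof.
move=> /andP[s1 s2]; case: k => [|k]; first by rewrite /= normr1 ler1n.
rewrite binomial_coef_pascal (le_trans (ler_normB _ _))//.
have b1 j : `|binomial_coef (s - 1) j| <= 1.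
  by apply: binomial_coef_le1; apply/andP; split; lra.
by have := b1 k.+1; have := b1 k; lra.
Qed.

Lemma cvg_pseries_unit_interval (f : R^nat) C t :
  (forall k, `|f k| <= C) -> `|t| < 1 -> cvgn (pseries f t).
Proof.
move=> fC t1; have t0 := normr_ge0 t.
apply: (@is_cvg_pseries_inside _ _ ((1 + `|t|) / 2)).
  by apply: is_cvg_pseries_bounded fC _; apply/andP; split; lra.
by rewrite [ltRHS]ger0_norm; lra.
Qed.

Lemma is_cvg_binomial_series s t : 1 < s < 2 -> `|t| < 1 ->
  cvgn (pseries (binomial_coef s) t).
Proof.
move=> s12; apply: cvg_pseries_unit_interval => k; exact: binomial_coef_le2.
Qed.

(** Let [F] and [G] be the sums of the series for the exponents [s] and [s - 1].
    Then [F' = - s G] and [F = (1 - t) G], so [F (1 - t)^(- s)] has zero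
    derivative.  Differentiating termwise requires the first two derived series
    to converge; their coefficients are multiples of those for the exponents
    [s - 1] and [s - 2], which are bounded because [1 < s < 2]. *)
Lemma binomial_seriesE s t : 1 < s < 2 -> `|t| < 1 ->
  limn (pseries (binomial_coef s) t) = (1 - t) `^ s.
Proof.
move=> s12; have /andP[s1 s2] := s12.
have b1 k : `|binomial_coef (s - 1) k| <= 1.
  by apply: binomial_coef_le1; apply/andP; split; lra.
have b2 k : `|binomial_coef (s - 1 - 1) k| <= 1.
  by apply: binomial_coef_le1; apply/andP; split; lra.
have b0 k := binomial_coef_le2 k s12.
have inK (x : R) : `|x| < 1 -> exists2 K, 0 <= K < 1 & `|x| < `|K|.
  move=> x1; have x0 := normr_ge0 x.
  exists ((1 + `|x|) / 2); first by apply/andP; split; lra.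
  by rewrite [ltRHS]ger0_norm; lra.
have diffs1 k : `|pseries_diffs (binomial_coef s) k| <= s.
  rewrite pseries_diffs_binomial_coef normrM normrN [`|s|]ger0_norm; last lra.
  by rewrite ler_piMr//; lra.
have diffs2 k : `|pseries_diffs (pseries_diffs (binomial_coef s)) k| <= s.
  rewrite pseries_diffs_binomial_coef.
  have -> : pseries_diffs (fun k => - s * binomial_coef (s - 1) k) k =
      - s * (- (s - 1) * binomial_coef (s - 1 - 1) k).
    have E : k.+1%:R * binomial_coef (s - 1) k.+1 =
        - (s - 1) * binomial_coef (s - 1 - 1) k.
      by have := congr1 (@^~ k) (pseries_diffs_binomial_coef (s - 1)).
    by rewrite -E /pseries_diffs mulrCA.
  rewrite !normrM !normrN [`|s|]ger0_norm; last lra.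
  rewrite [`|s - 1|]ger0_norm; last lra.
  by rewrite ler_piMr// ?mulr_ile1//; lra.
pose F (x : R) : R := limn (pseries (binomial_coef s) x).
pose G (x : R) : R := limn (pseries (binomial_coef (s - 1)) x).
have dF (x : R) : `|x| < 1 -> is_derive x 1 F (- s * G x).
  move=> x1; have [K K01 xK] := inK x x1.
  have -> : - s * G x = limn (pseries (pseries_diffs (binomial_coef s)) x).
    rewrite pseries_diffs_binomial_coef.
    have -> : pseries (fun k => - s * binomial_coef (s - 1) k) x =
        (fun n => - s * pseries (binomial_coef (s - 1)) x n).
      apply/funext => n; rewrite /pseries/series/= mulr_sumr.
      by apply: eq_bigr => k _; rewrite mulrA.
    apply/esym/cvg_lim => //; apply: cvgM; first exact: cvg_cst.
    exact: cvg_pseries_unit_interval b1 x1.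
  by apply: pseries_snd_diffs xK; apply: is_cvg_pseries_bounded K01.
have FG (x : R) : `|x| < 1 -> F x = (1 - x) * G x.
  move=> x1; apply: cvg_lim => //.
  have cG := cvg_pseries_unit_interval b1 x1.
  have -> : (1 - x) * G x = G x - x * G x by rewrite mulrBl mul1r.
  rewrite -(cvg_shiftS (pseries _ _)).
  have -> : (fun n => pseries (binomial_coef s) x n.+1) =
      (fun n => pseries (binomial_coef (s - 1)) x n.+1 -
        x * pseries (binomial_coef (s - 1)) x n).
    apply/funext => n; rewrite /pseries/series/= !big_nat_recl//=.
    rewrite mulr_sumr -addrA; congr (_ + _); rewrite -sumrB.
    apply: eq_bigr => k _; rewrite -[LHS]/(binomial_coef s k.+1 * x ^+ k.+1).
    rewrite -[X in X * x ^+ k.+1 - _]/(binomial_coef (s - 1) k.+1).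
    by rewrite binomial_coef_pascal exprS; ring.
  apply: cvgB; first by rewrite (cvg_shiftS (pseries _ _)).
  by apply: cvgM; [exact: cvg_cst|exact: cG].
pose H (x : R) : R := F x * (1 - x) `^ (- s).
have dH (x : R) : `|x| < 1 -> is_derive x 1 H 0.
  move=> x1; have x0 : 0 < 1 - x.
    by rewrite subr_gt0 (le_lt_trans (ler_norm _)).
  have dp : is_derive x 1 (fun x => (1 - x) `^ (- s))
      ((- s * (1 - x) `^ (- s - 1)) * -1).
    have := @is_derive1_comp R (fun y => y `^ (- s)) (fun x => 1 - x) x _ _
      (is_derive1_powR (- s) x0).
    apply; have := is_deriveB (is_derive_cst (1 : R) x 1) (is_derive_id x 1).
    by rewrite sub0r.
  have -> : H = F * (fun x => (1 - x) `^ (- s)) by [].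
  have D := is_deriveM (dF x x1) dp; apply: (is_derive_eq D).
  rewrite /= FG// powRB; last by apply/implyP => _; rewrite gt_eqF.
  rewrite powRr1 ?ltW// /GRing.scale/=; field.
  by rewrite gt_eqF.
move=> t1; have := derive0_unit_interval dH t1.
rewrite /H subr0 powR1 mulr1.
have -> : F 0 = 1.
  apply: cvg_lim => //; rewrite -(cvg_shiftS (pseries _ _)).
  apply: cvg_near_cst; apply: nearW => n.
  rewrite /pseries/series/= big_nat_recl//= expr0 mulr1 big1 ?addr0//.
  by move=> k _; rewrite expr0n/= mulr0.
have t0 : 0 < 1 - t by rewrite subr_gt0 (le_lt_trans (ler_norm _)).
rewrite powRN => h; rewrite -/(F t).
have p0 : (1 - t) `^ s != 0 by rewrite gt_eqF// powR_gt0.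
by rewrite -[LHS](divfK p0) h mul1r.
Qed.

Lemma binomial_coef_gt0 s k : 1 < s < 2 -> (2 <= k)%N -> 0 < binomial_coef s k.
Proof.
move=> /andP[s1 s2]; case: k => [|[|k]]// _; elim: k => [|k IHk].
  have -> : binomial_coef s 2 = s * (s - 1) / 2 by rewrite /=; field.
  by rewrite divr_gt0// mulr_gt0//; lra.
rewrite [binomial_coef _ _]/= -/(binomial_coef s k.+2).
rewrite divr_gt0// mulr_gt0// subr_gt0 (lt_le_trans s2)// ler_nat.
by rewrite ltnS.
Qed.

End binomial_series.

(** * Moments determine a probability measure *)

Section sgn_iterates.
Context {R : realType}.

(** On [-1, 1] this odd map fixes -1, 0 and 1, and its iterates push every other
    point towards 1 or -1 according to its sign: they are polynomials that
    approximate the sign function, boundedly and pointwise. *)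
Definition sgn_step (x : R) : R := (3 * x - x ^+ 3) / 2.

Lemma sgn_stepN (x : R) : sgn_step (- x) = - sgn_step x.
Proof. by rewrite /sgn_step; field. Qed.

Lemma iter_sgn_step_pos n (x : R) : 0 < x -> x <= 1 ->
  x <= iter n sgn_step x <= 1 /\ 1 - iter n sgn_step x <= (1 - x / 2) ^+ n.
Proof.
move=> x0 x1; elim: n => [|n [/andP[xy y1] IHn]] /=.
  by rewrite expr0 lexx x1; split => //; lra.
set y := iter n sgn_step x in xy y1 IHn *.
have y0 : 0 < y by exact: lt_le_trans xy.
have E1 : 1 - sgn_step y = (1 - y) * (1 - (y + y ^+ 2) / 2).
  by rewrite /sgn_step; field.
have h2 : 0 <= y ^+ 2 <= y by rewrite sqr_ge0 expr2 ler_piMl// ltW.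
have h1 : 0 <= 1 - (y + y ^+ 2) / 2 by move: h2 => /andP[h2 h3]; lra.
have step1 : 0 <= 1 - sgn_step y by rewrite E1 mulr_ge0// subr_ge0.
have step2 : x <= sgn_step y.
  apply: (le_trans xy); have -> : sgn_step y = y + y * (1 - y ^+ 2) / 2.
    by rewrite /sgn_step; field.
  rewrite lerDl divr_ge0// (mulr_ge0 (ltW y0))//.
  by move: h2 => /andP[_ h2]; rewrite subr_ge0 (le_trans h2).
split; first by rewrite step2/= -subr_ge0.
rewrite E1 [leRHS]exprSr; apply: ler_pM => //; first by rewrite subr_ge0.
by move: h2 => /andP[h2 h3]; lra.
Qed.

Lemma iter_sgn_stepN n (x : R) : iter n sgn_step (- x) = - iter n sgn_step x.
Proof. by elim: n => //= n ->; rewrite sgn_stepN. Qed.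

Lemma iter_sgn_step0 n : iter n sgn_step 0 = 0.
Proof.
elim: n => //= n ->.
by rewrite /sgn_step mulr0 expr0n/= subr0 mul0r.
Qed.

Lemma iter_sgn_step_le1 n (x : R) : `|x| <= 1 -> `|iter n sgn_step x| <= 1.
Proof.
wlog x0 : x / 0 <= x => [H x1|].
  have [x0|x0] := leP 0 x; first exact: H.
  by rewrite -normrN -iter_sgn_stepN H ?normrN// oppr_ge0 ltW.
rewrite ger0_norm//; move: x0; rewrite le_eqVlt => /predU1P[<-|x0 x1].
  by rewrite iter_sgn_step0 normr0.
have [/andP[xy y1] _] := iter_sgn_step_pos n x0 x1.
by rewrite ger0_norm// (le_trans _ xy)// ltW.
Qed.

Lemma cvg_iter_sgn_step (x : R) : `|x| <= 1 ->
  iter n sgn_step x @[n --> \oo] --> Num.sg x.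
Proof.
have pos (z : R) : 0 < z -> z <= 1 ->
    iter n sgn_step z @[n --> \oo] --> (1 : R).
  move=> z0 z1; apply: (@squeeze_cvgr _ _ _ _ (fun n => 1 - (1 - z / 2) ^+ n)
    (fun=> 1)).
  - apply: nearW => n; have [/andP[_ ->] h] := iter_sgn_step_pos n z0 z1.
    by rewrite andbT lerBlDr addrC -lerBlDr.
  - rewrite -[X in _ --> X]subr0; apply: cvgB; first exact: cvg_cst.
    by apply: cvg_expr; rewrite ger0_norm; lra.
  - exact: cvg_cst.
move=> x1; have [x0|x0|->] := ltgtP x 0.
- rewrite ltr0_sg//; rewrite -oppr_gt0 in x0.
  have := cvgN (pos (- x) x0 _).
  have -> : - (fun n => iter n sgn_step (- x)) = (fun n => iter n sgn_step x).
    by apply/funext => n; rewrite fctE iter_sgn_stepN opprK.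
  by apply; rewrite (le_trans (ler_norm _))// normrN.
- by rewrite gtr0_sg//; apply: pos => //; exact: le_trans (ler_norm _) x1.
- have -> : (fun n => iter n sgn_step 0) = (fun=> 0 : R).
    by apply/funext => n; exact: iter_sgn_step0.
  by rewrite sgr0; exact: cvg_cst.
Qed.

End sgn_iterates.

Section moments.
Context {R : realType} {disp : measure_display} {T : measurableType disp}.
Variables (mu nu : probability T R) (I : Type) (X : I -> T -> R).
Hypothesis mX : forall i, bounded_measurable (X i).
Hypothesis moments_eq : forall s : seq I,
  \int[mu]_x (\prod_(i <- s) X i x) = \int[nu]_x (\prod_(i <- s) X i x).

Let moments_agree (h : T -> R) := bounded_measurable h /\
  forall s : seq I, \int[mu]_x (h x * \prod_(i <- s) X i x) =
                    \int[nu]_x (h x * \prod_(i <- s) X i x).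

(** Unlike the set of functions with the same integral for [mu] and [nu], the set
    of multipliers is closed under products; it is an algebra closed under bounded
    pointwise limits that contains the [X i]. *)
Let multiplier (f : T -> R) := bounded_measurable f /\
  forall h, moments_agree h -> moments_agree (fun x => f x * h x).

Let mprod (s : seq I) : bounded_measurable (fun x => \prod_(i <- s) X i x).
Proof. exact: bounded_measurable_prod. Qed.

Let multiplier_cst c : multiplier (fun=> c).
Proof.
split=> [|h [mh h_eq]]; first exact: bounded_measurable_cst.
split=> [|s]; first exact/bounded_measurableM/mh/bounded_measurable_cst.
under eq_Rintegral do rewrite -mulrA.
under [RHS]eq_Rintegral do rewrite -mulrA.
by rewrite !bounded_RintegralZl ?h_eq//; exact: bounded_measurableM.
Qed.

Let multiplier_var i : multiplier (X i).
Proof.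
split=> // h [mh h_eq]; split=> [|s]; first exact: bounded_measurableM.
have := h_eq (i :: s).
under eq_Rintegral do rewrite big_cons mulrA [h _ * _]mulrC.
by under [in X in _ = X -> _]eq_Rintegral do
  rewrite big_cons mulrA [h _ * _]mulrC.
Qed.

Let multiplierD f g : multiplier f -> multiplier g ->
  multiplier (fun x => f x + g x).
Proof.
move=> [mf Mf] [mg Mg]; split=> [|h hQ]; first exact: bounded_measurableD.
have [mfh fh] := Mf h hQ; have [mgh gh] := Mg h hQ.
have -> : (fun x => (f x + g x) * h x) = (fun x => f x * h x + g x * h x).
  by apply/funext => x; rewrite mulrDl.
split=> [|s]; first exact: bounded_measurableD.
under eq_Rintegral do rewrite mulrDl.
under [RHS]eq_Rintegral do rewrite mulrDl.
by rewrite !bounded_RintegralD ?fh ?gh//; exact: bounded_measurableM.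
Qed.

Let multiplierM f g : multiplier f -> multiplier g ->
  multiplier (fun x => f x * g x).
Proof.
move=> [mf Mf] [mg Mg]; split=> [|h hQ]; first exact: bounded_measurableM.
have := Mf _ (Mg h hQ).
by under [X in moments_agree X -> _]eq_fun do rewrite mulrA.
Qed.

Let multiplier_cvg (F : nat -> T -> R) f C : (forall n, multiplier (F n)) ->
  (forall n x, `|F n x| <= C) -> (forall x, F n x @[n --> \oo] --> f x) ->
  multiplier f.
Proof.
move=> MF FC Ff; have mf : bounded_measurable f.
  by apply: bounded_measurable_cvg FC Ff => n; case: (MF n) => -[].
split=> // h hQ; have [mh _] := hQ.
split=> [|s]; first exact: bounded_measurableM.
have [_ [D hD]] := bounded_measurableM mh (mprod s).
have cv (m : probability T R) :
    \int[m]_x (F n x * h x * \prod_(i <- s) X i x) @[n --> \oo] -->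
    \int[m]_x (f x * h x * \prod_(i <- s) X i x).
  apply: (@bounded_Rintegral_cvg _ _ _ _ _ _ (C * D)).
  - by move=> n; have [] := bounded_measurableM ((MF n).2 h hQ).1 (mprod s).
  - by move=> n x; rewrite -mulrA normrM ler_pM.
  - move=> x; under eq_fun do rewrite -mulrA.
    by rewrite -mulrA; apply: cvgM; [exact: Ff|exact: cvg_cst].
have := cv mu.
have -> : (fun n => \int[mu]_x (F n x * h x * \prod_(i <- s) X i x)) =
    (fun n => \int[nu]_x (F n x * h x * \prod_(i <- s) X i x)).
  by apply/funext => n; exact: ((MF n).2 h hQ).2.
move=> cvmu; have := cvg_lim (@Rhausdorff R) cvmu.
by rewrite (cvg_lim (@Rhausdorff R) (cv nu)) => ->.
Qed.

(** The indicator of [0 < y] is the polynomial [(s^2 + s) / 2] in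
    [s = sgn y]. *)
Let multiplier_gt0 f : multiplier f -> (forall x, `|f x| <= 1) ->
  multiplier \1_[set x | 0 < f x].
Proof.
move=> Mf f1.
have Msg : multiplier (fun x => Num.sg (f x)).
  apply: (@multiplier_cvg (fun n x => iter n sgn_step (f x)) _ 1).
  - elim=> //= n IHn.
    have -> : (fun x => sgn_step (iter n sgn_step (f x))) = (fun x =>
        3 / 2 * iter n sgn_step (f x) + - 2^-1 * (iter n sgn_step (f x) *
          (iter n sgn_step (f x) * iter n sgn_step (f x)))).
      by apply/funext => x; rewrite /sgn_step; field.
    do ![apply: multiplierD|apply: multiplierM|apply: multiplier_cst] => //.
  - by move=> n x; exact: iter_sgn_step_le1.
  - by move=> x; exact: cvg_iter_sgn_step.
have -> : \1_[set x | 0 < f x] =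
    (fun x => 2^-1 * (Num.sg (f x) * Num.sg (f x) + Num.sg (f x))) :> (T -> R).
  apply/funext => x; rewrite indicE.
  have [fx|fx|fx] := ltrgt0P (f x).
  - by rewrite mem_set//= gtr0_sg// mulr1 -mulr2n mulVf// pnatr_eq0.
  - by rewrite memNset/= ?ltr0_sg ?mulrNN ?mulr1 ?subrr ?mulr0//; apply/negP;
      rewrite -leNgt ltW.
  - by rewrite memNset/= fx ?ltxx// sgr0 !mulr0 addr0 mulr0.
by do ![apply: multiplierD|apply: multiplierM|apply: multiplier_cst].
Qed.

(** The sets whose indicator is a multiplier form a sigma-algebra: complements
    and countable unions are obtained from [1 - f], from finite products and from
    a bounded limit.  It contains the sets [a < X i]; and a multiplier has the
    same integral for both measures. *)
Lemma moments_determine (A : set T) :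
  <<s [set A | exists i a, A = [set x | a < X i x]] >> A -> mu A = nu A.
Proof.
suff : <<s [set A | exists i a, A = [set x | a < X i x]] >> `<=`
    [set A | measurable A /\ multiplier \1_A].
  move=> /[apply] -[mA [m1 /(_ (fun=> 1))]] [].
    by split; [exact: bounded_measurable_cst|move=> s; under eq_Rintegral do
      rewrite mul1r; under [RHS]eq_Rintegral do rewrite mul1r].
  move=> _ /(_ [::]); under eq_Rintegral do rewrite big_nil !mulr1.
  under [RHS]eq_Rintegral do rewrite big_nil !mulr1.
  rewrite /Rintegral !integral_indic// !setIT => h.
  rewrite -[LHS]fineK; last exact: fin_num_measure.
  by rewrite [X in X%:E]h fineK//; exact: fin_num_measure.
apply: smallest_sub; first split => /=.
- split=> //; rewrite indic0; exact: multiplier_cst.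
- move=> B [mB MB]; rewrite setTD; split; first exact: measurableC.
  have -> : \1_(~` B) = (fun x => 1 + - 1 * \1_B x) :> (T -> R).
    apply/funext => x; rewrite !indicE in_setC; case: (x \in B) => /=.
      by rewrite mulr1 subrr.
    by rewrite mulr0 addr0.
  by apply: multiplierD; [|apply: multiplierM].
- move=> F MF; split; first by apply: bigcup_measurable => k _; case: (MF k).
  pose U n x : R := 1 + - 1 * \prod_(k < n) (1 + - 1 * \1_(F k) x).
  have Uin n x : U n x = (`[< exists2 k, (k < n)%N & F k x >])%:R.
    rewrite /U; case: asboolP => [[k kn Fkx]|nF].
      rewrite (bigD1 (Ordinal kn))//= indicE mem_set//= mulr1 subrr mul0r.
      by rewrite mulr0 addr0.
    rewrite big1 ?mulr1 ?subrr// => k _.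
    rewrite indicE memNset/= ?mulr0 ?addr0//.
    by move=> Fkx; apply: nF; exists k.
  apply: (@multiplier_cvg U _ 1).
  + move=> n; apply: multiplierD => //; apply: multiplierM => //.
    elim: n => [|n IHn]; first by under eq_fun do rewrite big_ord0.
    under eq_fun do rewrite big_ord_recr/=.
    apply: multiplierM => //; apply: multiplierD => //.
    by apply: multiplierM => //; case: (MF n).
  + by move=> n x; rewrite Uin normr_nat; case: asbool; rewrite ?lexx ?ler01.
  + move=> x; apply: cvg_near_cst; rewrite indicE.
    have [[k _ Fkx]|nF] := pselect ((\bigcup_k F k) x).
      exists k.+1 => // n /= kn; rewrite Uin mem_set; last by exists k.
      by rewrite asboolT//; exists k.
    apply: nearW => n; rewrite Uin memNset// asboolF// => -[k _ Fkx].
    by apply: nF; exists k.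
move=> _ [i [a ->]].
(* Rescaling makes [X i - a] take its values in [-1, 1]. *)
have [_ [C XC]] := mX i; pose K := `|C| + `|a| + 1.
have K0 : 0 < K by rewrite ltr_wpDl// addr_ge0.
pose f x := K^-1 * (X i x + - 1 * a).
have Mf : multiplier f.
  do ![apply: multiplierD|apply: multiplierM|apply: multiplier_cst].
  exact: multiplier_var.
have f1 x : `|f x| <= 1.
  rewrite normrM gtr0_norm ?invr_gt0// mulrC ler_pdivrMr// mul1r mulN1r.
  rewrite (le_trans (ler_normB _ _))// /K -addrA lerD//.
    by rewrite (le_trans (XC x))// ler_norm.
  by rewrite lerDl.
have fE : [set x | a < X i x] = [set x | 0 < f x].
  apply/seteqP; split => x /=;
    by rewrite pmulr_rgt0 ?invr_gt0// mulN1r subr_gt0.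
split; last by rewrite fE; exact: multiplier_gt0.
have := (mX i).1 measurableT _ (measurable_itv `]a, +oo[); rewrite setTI.
by congr measurable; apply/seteqP; split => x /=; rewrite in_itv/= andbT.
Qed.

End moments.

(** * Mutual energies and moments *)

Section mutual_energy.
Context {R : realType} {d : nat}.
Local Notation S := (usphere R d).
Implicit Types (mu nu : probability S R) (phi : R -> R) (v w : S).
Local Notation sigma := (uniform_sphere R d).

Definition sdot v w : R := dot (sphere_val v) (sphere_val w).

Lemma sdot_le1 v w : `|sdot v w| <= 1.
Proof.
have sq (x : 'rV[R]_d.+1) : 0 <= dot x x.
  by apply: sumr_ge0 => i _; exact: sqr_ge0.
have := sq (sphere_val v - sphere_val w).
have := sq (sphere_val v + sphere_val w).
rewrite dotBl ![dot _ (_ - _)]dotC !dotBl dotDl ![dot _ (_ + _)]dotC !dotDl.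
rewrite !dot_sphere_val [dot (sphere_val w) (sphere_val v)]dotC -/(sdot v w).
by move=> h1 h2; rewrite ler_norml; apply/andP; split; lra.
Qed.

Definition monomial (s : seq 'I_d.+1) v : R := \prod_(i <- s) sphere_val v 0 i.

Definition moment mu s : R := \int[mu]_v monomial s v.

Definition word k (e : {ffun 'I_k -> 'I_d.+1}) : seq 'I_d.+1 :=
  [seq e j | j <- enum 'I_k].

Lemma monomial_word k (e : {ffun 'I_k -> 'I_d.+1}) v :
  monomial (word e) v = \prod_j sphere_val v 0 (e j).
Proof. by rewrite /monomial /word big_map big_enum. Qed.

Lemma sdot_pow k v w : sdot v w ^+ k =
  \sum_(e : {ffun 'I_k -> 'I_d.+1}) monomial (word e) v * monomial (word e) w.
Proof.
rewrite -[in LHS](card_ord k) -prodr_const /sdot /dot bigA_distr_bigA/=.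
by apply: eq_bigr => e _; rewrite !monomial_word -big_split.
Qed.

Lemma bounded_measurable_monomial s : bounded_measurable (monomial s).
Proof.
by apply: bounded_measurable_prod => i; exact: bounded_measurable_coord.
Qed.

Definition mutual_energy phi mu nu : R :=
  \int[mu]_v \int[nu]_w phi (sdot v w).

(** What the nested integral defining [mutual_energy] needs to behave well: both
    the inner and the outer integrand are bounded and measurable. *)
Definition energy_kernel phi :=
  (forall v, bounded_measurable (fun w => phi (sdot v w))) /\
  (forall nu, bounded_measurable (fun v => \int[nu]_w phi (sdot v w))).

Lemma Rintegral_sdot_pow k nu v : \int[nu]_w (sdot v w ^+ k) =
  \sum_(e : {ffun 'I_k -> 'I_d.+1}) moment nu (word e) * monomial (word e) v.
Proof.
under eq_Rintegral do rewrite sdot_pow.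
have mM (e : {ffun 'I_k -> 'I_d.+1}) :
    bounded_measurable (fun w => monomial (word e) v * monomial (word e) w).
  by apply: bounded_measurableM (bounded_measurable_monomial _);
    exact: bounded_measurable_cst.
rewrite bounded_Rintegral_sum//; apply: eq_bigr => e _.
by rewrite bounded_RintegralZl 1?mulrC//; exact: bounded_measurable_monomial.
Qed.

Lemma energy_kernel_pow k : energy_kernel (fun x => x ^+ k).
Proof.
split=> [v|nu].
  under eq_fun do rewrite sdot_pow.
  apply: bounded_measurable_sum => e.
  apply: bounded_measurableM (bounded_measurable_monomial _).
  exact: bounded_measurable_cst.
under eq_fun do rewrite Rintegral_sdot_pow.
apply: bounded_measurable_sum => e.
apply: bounded_measurableM (bounded_measurable_monomial _).
exact: bounded_measurable_cst.
Qed.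

Lemma mutual_energy_pow k mu nu : mutual_energy (fun x => x ^+ k) mu nu =
  \sum_(e : {ffun 'I_k -> 'I_d.+1}) moment mu (word e) * moment nu (word e).
Proof.
rewrite /mutual_energy; under eq_Rintegral do rewrite Rintegral_sdot_pow.
have mM (e : {ffun 'I_k -> 'I_d.+1}) :
    bounded_measurable (fun v => moment nu (word e) * monomial (word e) v).
  by apply: bounded_measurableM (bounded_measurable_monomial _);
    exact: bounded_measurable_cst.
rewrite bounded_Rintegral_sum//; apply: eq_bigr => e _.
by rewrite bounded_RintegralZl 1?mulrC//; exact: bounded_measurable_monomial.
Qed.

Lemma energy_kernel_poly n (c : nat -> R) :
  energy_kernel (fun x => \sum_(k < n) c k * x ^+ k).
Proof.
split=> [v|nu].
  apply: bounded_measurable_sum => k.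
  by apply: bounded_measurableM; [exact: bounded_measurable_cst|
    exact: (energy_kernel_pow k).1].
have -> : (fun v => \int[nu]_w (\sum_(k < n) c k * sdot v w ^+ k)) =
    (fun v => \sum_(k < n) c k * \int[nu]_w (sdot v w ^+ k)).
  apply/funext => v; rewrite bounded_Rintegral_sum//.
    by apply: eq_bigr => k _; rewrite bounded_RintegralZl//;
      exact: (energy_kernel_pow k).1.
  by move=> k; apply: bounded_measurableM; [exact: bounded_measurable_cst|
    exact: (energy_kernel_pow k).1].
apply: bounded_measurable_sum => k.
by apply: bounded_measurableM; [exact: bounded_measurable_cst|
  exact: (energy_kernel_pow k).2].
Qed.

Lemma mutual_energy_poly n (c : nat -> R) mu nu :
  mutual_energy (fun x => \sum_(k < n) c k * x ^+ k) mu nu =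
  \sum_(k < n) c k * mutual_energy (fun x => x ^+ k) mu nu.
Proof.
have mk v (k : 'I_n) : bounded_measurable (fun w => c k * sdot v w ^+ k).
  by apply: bounded_measurableM; [exact: bounded_measurable_cst|
    exact: (energy_kernel_pow k).1].
rewrite /mutual_energy.
under eq_Rintegral => v _.
  rewrite bounded_Rintegral_sum//.
  under eq_bigr => k _.
    rewrite bounded_RintegralZl; last exact: (energy_kernel_pow k).1.
    over.
  over.
rewrite bounded_Rintegral_sum => [|k]; last first.
  by apply: bounded_measurableM; [exact: bounded_measurable_cst|
    exact: (energy_kernel_pow k).2].
by apply: eq_bigr => k _; rewrite bounded_RintegralZl//;
  exact: (energy_kernel_pow k).2.
Qed.

Lemma mutual_energy_cvg (F : nat -> R -> R) phi C :
  (forall n, energy_kernel (F n)) ->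
  (forall n x, `|x| <= 1 -> `|F n x| <= C) ->
  (forall x, `|x| <= 1 -> F n x @[n --> \oo] --> phi x) ->
  energy_kernel phi /\ forall mu nu,
    mutual_energy (F n) mu nu @[n --> \oo] --> mutual_energy phi mu nu.
Proof.
move=> kF FC Fphi.
have bF v n w : `|F n (sdot v w)| <= C by apply: FC; exact: sdot_le1.
have cF v w : F n (sdot v w) @[n --> \oo] --> phi (sdot v w).
  by apply: Fphi; exact: sdot_le1.
have mF v n : measurable_fun setT (fun w => F n (sdot v w)).
  by case: ((kF n).1 v).
have cI nu v : \int[nu]_w F n (sdot v w) @[n --> \oo] -->
    \int[nu]_w phi (sdot v w).
  exact: (@bounded_Rintegral_cvg _ _ _ nu (fun n w => F n (sdot v w)) _ C).
have bI nu n v : `|\int[nu]_w F n (sdot v w)| <= C.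
  by apply: bounded_Rintegral_le; [exact: (kF n).1|exact: bF].
have mI nu n : measurable_fun setT (fun v => \int[nu]_w F n (sdot v w)).
  by case: ((kF n).2 nu).
split; first split.
- move=> v.
  exact: (@bounded_measurable_cvg _ _ _ (fun n w => F n (sdot v w)) _ C).
- by move=> nu; exact: (@bounded_measurable_cvg _ _ _
    (fun n v => \int[nu]_w F n (sdot v w)) _ C).
- by move=> mu nu; exact: (@bounded_Rintegral_cvg _ _ _ mu
    (fun n v => \int[nu]_w F n (sdot v w)) _ C).
Qed.

(** The squared norm of the difference of the [k]-th moment tensors of [mu] and of
    the uniform measure. *)
Definition moment_gap k mu : R :=
  \sum_(e : {ffun 'I_k -> 'I_d.+1})
    (moment mu (word e) - moment sigma (word e)) ^+ 2.

Lemma moment_gap_ge0 k mu : 0 <= moment_gap k mu.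
Proof. by apply: sumr_ge0 => e _; exact: sqr_ge0. Qed.

(** Apply the reflection exchanging [v] and [w] to the variable of
    integration. *)
Lemma uniform_potential_cst k v w : (0 < d)%N ->
  \int[sigma]_x (sdot v x ^+ k) = \int[sigma]_x (sdot w x ^+ k).
Proof.
move=> d0.
rewrite -[RHS](Rintegral_sphere_refl (sphere_val v - sphere_val w) d0);
  last exact: (energy_kernel_pow k).1.
apply: eq_Rintegral => x _; congr (_ ^+ _).
rewrite /sdot sphere_reflE -[LHS](dot_refl (sphere_val v - sphere_val w)).
by rewrite refl_swap// !dot_sphere_val.
Qed.

(** Expand the square: since the potential of [sigma] is constant, the cross term
    equals the energy of [sigma]. *)
Lemma mutual_energy_pow_gap k mu : (0 < d)%N ->
  mutual_energy (fun x => x ^+ k) mu mu -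
  mutual_energy (fun x => x ^+ k) sigma sigma = moment_gap k mu.
Proof.
move=> d0; have cst nu : mutual_energy (fun x => x ^+ k) nu sigma =
    \int[sigma]_x (sdot point x ^+ k).
  rewrite -[RHS](Rintegral_probability_cst nu).
  by apply: eq_Rintegral => v _; exact: uniform_potential_cst.
have := etrans (cst mu) (esym (cst sigma)).
rewrite !mutual_energy_pow => cross.
set mm := \sum_e moment mu (word e) * moment mu (word e).
set ms := \sum_e moment mu (word e) * moment sigma (word e) in cross *.
set ss := \sum_e _ in cross *.
transitivity (mm - 2 * ms + ss); first by rewrite cross; ring.
rewrite /mm /ms /ss mulr_sumr -sumrB -big_split.
by apply: eq_bigr => e _ /=; ring.
Qed.

Lemma moment0 mu : moment mu [::] = 1.
Proof.
rewrite /moment /monomial; under eq_Rintegral do rewrite big_nil.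
exact: Rintegral_probability_cst.
Qed.

Lemma centered_moment1 mu i : centered_probability mu -> moment mu [:: i] = 0.
Proof.
move=> /rowP/(_ i); rewrite !mxE => h; rewrite -[RHS]h.
by apply: eq_Rintegral => v _; rewrite /monomial big_seq1.
Qed.

Lemma moment_gap0 mu : moment_gap 0 mu = 0.
Proof.
apply: big1 => e _; have -> : word e = [::].
  by apply/nilP; rewrite /nilp size_map size_enum_ord.
by rewrite !moment0 subrr expr0n.
Qed.

Lemma centered_moment_gap1 mu : (0 < d)%N -> centered_probability mu ->
  moment_gap 1 mu = 0.
Proof.
move=> d0 mu0; apply: big1 => e _.
have : size (word e) = 1%N by rewrite size_map size_enum_ord.
case: (word e) => [|i [|]]// _.
by rewrite !centered_moment1// ?subrr ?expr0n//; exact: uniform_sphere_centered.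
Qed.

Lemma moment_gap_eq0 mu (s : seq 'I_d.+1) :
  moment_gap (size s) mu = 0 -> moment mu s = moment sigma s.
Proof.
move=> /eqP; rewrite psumr_eq0 => [/allP gap0|e _]; last exact: sqr_ge0.
pose e : {ffun 'I_(size s) -> 'I_d.+1} := [ffun j => tnth (in_tuple s) j].
have es : word e = s.
  rewrite /word -[RHS](map_tnth_enum (in_tuple s)).
  by apply: eq_map => j; rewrite ffunE.
have := gap0 e (mem_index_enum _).
by rewrite es/= sqrf_eq0 subr_eq0 => /eqP.
Qed.

End mutual_energy.

(** * Comparison of energies *)

Lemma cvg_sub_ge (R : realType) (u v : R^nat) (a b x : R) :
  u @ \oo --> a -> v @ \oo --> b -> (\forall n \near \oo, x <= u n - v n) ->
  x <= a - b.
Proof.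
move=> ua vb xuv; have uv : u n - v n @[n --> \oo] --> a - b by exact: cvgB.
rewrite -(cvg_lim (@Rhausdorff R) uv); apply: limr_ge => //.
by apply/cvg_ex; exists (a - b).
Qed.

Section energy_gap.
Context {R : realType} {d : nat}.
Local Notation S := (usphere R d).
Implicit Types (mu nu : probability S R) (v w : S).
Local Notation sigma := (uniform_sphere R d).

(** Dilating the argument by [r < 1] makes the binomial series converge uniformly
    on [-1, 1], so the energies are limits of those of the partial sums; there all
    terms but the [k]-th are dropped, the orders 0 and 1 contributing nothing. *)
Lemma energy_kernel_dilated_power (q r : R) :
  1 < q < 2 -> 0 <= r < 1 ->
  energy_kernel (fun x => (1 - r * x) `^ q) (d := d) /\
  forall k mu, (2 <= k)%N -> (0 < d)%N -> centered_probability mu ->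
    binomial_coef q k * r ^+ k * moment_gap k mu <=
    mutual_energy (fun x => (1 - r * x) `^ q) mu mu -
    mutual_energy (fun x => (1 - r * x) `^ q) sigma sigma.
Proof.
move=> q12 /andP[r0 r1]; pose c k := binomial_coef q k * r ^+ k.
pose F n (x : R) := \sum_(k < n) c k * x ^+ k.
have small (x : R) : `|x| <= 1 -> `|r * x| < 1.
  move=> x1; rewrite normrM (ger0_norm r0); apply: le_lt_trans r1.
  by rewrite ler_piMr.
have c2 k : `|c k| <= 2 * r ^+ k.
  rewrite normrM normrX (ger0_norm r0) ler_wpM2r ?exprn_ge0//.
  exact: binomial_coef_le2.
have FC n x : `|x| <= 1 -> `|F n x| <= 2 / (1 - r).
  move=> x1; apply: le_trans (ler_norm_sum _ _ _) _.
  apply: (@le_trans _ _ (\sum_(k < n) 2 * r ^+ k)).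
    apply: ler_sum => k _; rewrite normrM normrX.
    by apply: le_trans (c2 k); rewrite ler_piMr// exprn_ile1.
  rewrite -mulr_sumr ler_wpM2l// -[leRHS]div1r ler_pdivlMr ?subr_gt0//.
  rewrite mulrC -opprB mulNr -subrX1 opprB gerBl exprn_ge0//.
have Fcvg x : `|x| <= 1 -> F n x @[n --> \oo] --> (1 - r * x) `^ q.
  move=> x1; rewrite -binomial_seriesE//; last exact: small.
  have -> : (fun n => F n x) = pseries (binomial_coef q) (r * x).
    apply/funext => n; rewrite /F /pseries/series/= big_mkord.
    by apply: eq_bigr => k _; rewrite exprMn mulrA.
  exact: (is_cvg_binomial_series q12 (small x x1)).
have [kphi cphi] := @mutual_energy_cvg R d F _ _
  (fun n => energy_kernel_poly n c) FC Fcvg.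
split=> // k mu k2 d0 mu0.
apply: cvg_sub_ge (cphi mu mu) (cphi sigma sigma) _.
exists k.+1 => // n /= kn; rewrite /= !mutual_energy_poly.
rewrite -sumrB (bigD1 (Ordinal kn))//= -mulrBr mutual_energy_pow_gap//.
rewrite lerDl; apply: sumr_ge0 => -[[|[|j]] jn] _ /=;
  rewrite -mulrBr mutual_energy_pow_gap//.
- by rewrite moment_gap0 mulr0.
- by rewrite centered_moment_gap1// mulr0.
- rewrite mulr_ge0 ?moment_gap_ge0//.
  by rewrite mulr_ge0 ?exprn_ge0// ltW// binomial_coef_gt0.
Qed.

Lemma cvg_dilation : (1 - (n.+2%:R)^-1 : R) @[n --> \oo] --> (1 : R).
Proof.
rewrite -[X in _ --> X]subr0; apply: cvgB; first exact: cvg_cst.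
have := @cvg_harmonic R; by rewrite -(cvg_shiftS (harmonic : nat -> R)).
Qed.

(** Let [r] tend to 1 along [1 - 1 / (n + 2) >= 1 / 2]; the factor [r^k] is then
    bounded below by [2^(- k)]. *)
Lemma energy_kernel_power (q : R) :
  1 < q < 2 ->
  energy_kernel (fun x => (1 - x) `^ q) (d := d) /\
  forall k mu, (2 <= k)%N -> (0 < d)%N -> centered_probability mu ->
    binomial_coef q k * 2^-1 ^+ k * moment_gap k mu <=
    mutual_energy (fun x => (1 - x) `^ q) mu mu -
    mutual_energy (fun x => (1 - x) `^ q) sigma sigma.
Proof.
move=> q12; have /andP[q1 q2] := q12.
pose r n : R := 1 - n.+2%:R^-1.
have r01 n : 2^-1 <= r n < 1.
  rewrite /r ltrBlDr ltrDl invr_gt0 ltr0n andbT.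
  have : n.+2%:R^-1 <= 2^-1 :> R by rewrite lef_pV2 ?posrE// ler_nat.
  by move: (n.+2%:R^-1 : R) => y; lra.
have r0 n : 0 <= r n < 1.
  by have /andP[h ->] := r01 n; rewrite andbT (le_trans _ h).
pose F n (x : R) := (1 - r n * x) `^ q.
have kF n := energy_kernel_dilated_power q12 (r0 n).
have base n (x : R) : `|x| <= 1 -> 0 <= 1 - r n * x <= 2.
  have /andP[rn0 rn1] := r0 n; move=> x1.
  have : `|r n * x| <= 1 by rewrite normrM (ger0_norm rn0) mulr_ile1// ltW.
  by rewrite ler_norml => /andP[h1 h2]; apply/andP; split; lra.
have FC n x : `|x| <= 1 -> `|F n x| <= 2 `^ q.
  move=> /(base n)/andP[b0 b2]; rewrite ger0_norm ?powR_ge0//.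
  by apply: ge0_ler_powR; rewrite ?nnegrE//; lra.
have cb (x : R) : 1 - r n * x @[n --> \oo] --> 1 - x.
  apply: cvgB; first exact: cvg_cst.
  rewrite -[X in _ --> X]mul1r.
  by apply: cvgM; [exact: cvg_dilation|exact: cvg_cst].
have Fcvg x : `|x| <= 1 -> F n x @[n --> \oo] --> (1 - x) `^ q.
  move=> x1; have [x1'|x1'] := eqVneq x 1.
    rewrite x1' subrr powR0; last by rewrite gt_eqF//; lra.
    apply: (@squeeze_cvgr _ _ _ _ (fun=> 0) (fun n => 1 - r n * 1)).
    - apply: nearW => n; rewrite powR_ge0/=; apply: ge1r_powR; last exact: ltW.
      have /andP[h1 h2] := r01 n; rewrite mulr1; apply/andP; split; last lra.
      by rewrite subr_gt0.
    - exact: cvg_cst.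
    - by rewrite -(subrr (1 : R)); exact: cb.
  have x0 : 0 < 1 - x.
    by rewrite subr_gt0 lt_neqAle x1' (le_trans (ler_norm _)).
  have [/derivable1_diffP dp _] := @is_derive1_powR R q (1 - x) x0.
  exact: (cvg_comp _ _ (cb x) (differentiable_continuous dp)).
have [kphi cphi] := @mutual_energy_cvg R d F _ _ (fun n => (kF n).1) FC Fcvg.
split=> // k mu k2 d0 mu0.
apply: cvg_sub_ge (cphi mu mu) (cphi sigma sigma) _.
apply: nearW => n; apply: le_trans ((kF n).2 k mu k2 d0 mu0).
rewrite ler_wpM2r ?moment_gap_ge0// ler_wpM2l//.
  by rewrite ltW// binomial_coef_gt0.
by have /andP[h1 h2] := r01 n; rewrite lerXn2r ?nnegrE// (le_trans _ h1).
Qed.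

Lemma eucl_dist_powR (p : R) v w :
  eucl_dist (sphere_val v) (sphere_val w) `^ p =
  2 `^ (p / 2) * (1 - sdot v w) `^ (p / 2).
Proof.
have := sdot_le1 v w; rewrite ler_norml => /andP[_ s1].
have -> : eucl_dist (sphere_val v) (sphere_val w) =
    Num.sqrt (2 * (1 - sdot v w)).
  rewrite /eucl_dist eucl_norm_dot; congr Num.sqrt.
  rewrite dotBl ![dot _ (_ - _)]dotC !dotBl !dot_sphere_val.
  by rewrite [dot (sphere_val w) _]dotC -/(sdot v w); ring.
rewrite -powR12_sqrt; last by rewrite mulr_ge0// subr_ge0.
by rewrite -powRrM [2^-1 * p]mulrC powRM// subr_ge0.
Qed.

Lemma energyE (p : R) mu : 2 < p < 4 ->
  energy p mu = (2 `^ (p / 2) *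
    mutual_energy (fun x => (1 - x) `^ (p / 2)) mu mu)%:E.
Proof.
move=> /andP[p2 p4]; have q12 : 1 < p / 2 < 2 by apply/andP; split; lra.
have [[k1 k2] _] := energy_kernel_power q12.
rewrite /energy /mutual_energy.
have inner v : (\int[mu]_w
    (eucl_dist (sphere_val v) (sphere_val w) `^ p)%:E)%E =
    (2 `^ (p / 2) * \int[mu]_w (1 - sdot v w) `^ (p / 2))%:E.
  under eq_integral do rewrite eucl_dist_powR.
  rewrite -bounded_RintegralZl// /Rintegral fineK//.
  apply: integrable_fin_num => //.
  apply: (bounded_measurable_integrable mu (f := fun w =>
    2 `^ (p / 2) * (1 - sdot v w) `^ (p / 2))).
  by apply: bounded_measurableM => //; exact: bounded_measurable_cst.
under eq_integral do rewrite inner.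
rewrite -bounded_RintegralZl// /Rintegral fineK//.
apply: integrable_fin_num => //.
apply: (bounded_measurable_integrable mu (f := fun v =>
  2 `^ (p / 2) * \int[mu]_w (1 - sdot v w) `^ (p / 2))).
by apply: bounded_measurableM => //; exact: bounded_measurable_cst.
Qed.

Lemma energy_gap (p : R) mu k : 2 < p < 4 -> (0 < d)%N -> (2 <= k)%N ->
  centered_probability mu ->
  exists2 a : R, 0 < a &
    (energy p sigma + (a * moment_gap k mu)%:E <= energy p mu)%E.
Proof.
move=> p24 d0 k2 mu0; have /andP[p2 p4] := p24.
have q12 : 1 < p / 2 < 2 by apply/andP; split; lra.
exists (2 `^ (p / 2) * (binomial_coef (p / 2) k * 2^-1 ^+ k)).
  rewrite mulr_gt0 ?powR_gt0// mulr_gt0 ?exprn_gt0 ?invr_gt0//.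
  exact: binomial_coef_gt0.
rewrite !energyE// -EFinD lee_fin -mulrA -mulrDr ler_wpM2l ?powR_ge0//.
by rewrite addrC -lerBrDr; have [_] := energy_kernel_power q12; apply.
Qed.

Lemma uniform_sphere_minimizes (p : R) mu : 2 < p < 4 -> (0 < d)%N ->
  centered_probability mu -> (energy p sigma <= energy p mu)%E.
Proof.
move=> p24 d0 mu0; have [a a0 h] := energy_gap p24 d0 (leqnn 2) mu0.
by apply: le_trans h; rewrite leeDl// lee_fin mulr_ge0 ?moment_gap_ge0// ltW.
Qed.

Lemma uniform_sphere_unique_minimizer (p : R) mu : 2 < p < 4 -> (0 < d)%N ->
  centered_probability mu -> energy p mu = energy p sigma ->
  forall A : set S, measurable A -> mu A = sigma A.
Proof.
move=> p24 d0 mu0 eq_energy A mA.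
apply: (moments_determine bounded_measurable_coord)
  (measurable_usphere_half_spheres mA) => s.
change (moment mu s = moment sigma s).
have sigma0 := @uniform_sphere_centered R d d0.
case: s => [|i [|j s]]; first by rewrite !moment0.
  by rewrite !centered_moment1.
apply: moment_gap_eq0; set k := size _.
have [a a0] := energy_gap p24 d0 (isT : (2 <= k)%N) mu0.
rewrite eq_energy energyE// -EFinD lee_fin gerDl pmulr_rle0// => gap_le0.
by apply/eqP; rewrite eq_le gap_le0 moment_gap_ge0.
Qed.

End energy_gap.

Theorem proposition4p7 (R : realType) (n : nat) (p : R)
    (hn : (2 <= n)%N) (hp2 : 2 < p) (hp4 : p < 4) :
  [/\ min_energy n p = energy p (uniform_sphere R n.-1),
      centered_probability (uniform_sphere R n.-1)
    & forall mu : probability (usphere R n.-1) R,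
        centered_probability mu -> energy p mu = min_energy n p ->
        forall A : set (usphere R n.-1), measurable A ->
          mu A = uniform_sphere R n.-1 A].
Proof.
have d0 : (0 < n.-1)%N by case: n hn => [|[]].
have p24 : 2 < p < 4 by rewrite hp2.
have sigma0 := @uniform_sphere_centered R n.-1 d0.
have minE : min_energy n p = energy p (uniform_sphere R n.-1).
  apply/eqP; rewrite eq_le; apply/andP; split.
    by apply: ereal_inf_lbound; exists (uniform_sphere R n.-1).
  by apply: le_ereal_inf_tmp => _ [mu mu0 <-]; exact: uniform_sphere_minimizes.
split=> // mu mu0; rewrite minE.
exact: uniform_sphere_unique_minimizer.
Qed.
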